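(* Let $\mathcal{G} = (G^0, \mathcal{G}^1, r, s)$ be an ultragraph. Then $C^*(\mathcal{G})$ is an AF-algebra if and only if $\mathcal{G}$ has no loops.
   Context: An ultragraph $\mathcal{G} = (G^0, \mathcal{G}^1, r, s)$ consists of a countable set $G^0$ of vertices, a countable set $\mathcal{G}^1$ of edges, and functions $s : \mathcal{G}^1 \to G^0$ and $r : \mathcal{G}^1 \to P(G^0)$, where $P(G^0)$ is the collection of nonempty subsets of $G^0$. $\mathcal{G}^0$ denotes the smallest collection of subsets of $G^0$ that contains $\{v\}$ for all $v \in G^0$, contains $r(e)$ for all $e \in \mathcal{G}^1$, and is closed under (nonempty) finite intersections and finite unions; the empty set is regarded as an element of $\mathcal{G}^0$. A Cuntz-Krieger $\mathcal{G}$-family is a collection of partial isometries $\{s_e : e \in \mathcal{G}^1\}$ with mutually orthogonal ranges and projections $\{p_A : A \in \mathcal{G}^0\}$ with: (i) $p_\emptyset = 0$, $p_Ap_B = p_{A\cap B}$, $p_{A \cup B} = p_A + p_B - p_{A \cap B}$ for all $A,B \in \mathcal{G}^0$; (ii) $s_e^*s_e = p_{r(e)}$ for all $e \in \mathcal{G}^1$; (iii) $s_es_e^* \leq p_{s(e)}$ for all $e \in \mathcal{G}^1$; (iv) $p_v = \sum_{s(e)=v} s_es_e^*$ whenever $0 < |s^{-1}(v)| < \infty$ (where $p_v := p_{\{v\}}$). $C^*(\mathcal{G})$ is the $C^*$-algebra generated by a universal Cuntz-Krieger $\mathcal{G}$-family. A loop in $\mathcal{G}$ is a sequence of edges $\alpha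 = \alpha_1 \ldots \alpha_n$ with $n \ge 1$, $s(\alpha_{i+1}) \in r(\alpha_i)$ for $1 \le i < n$, and $s(\alpha_1) \in r(\alpha_n)$. *)

(* Defs.v *)
From HB Require Import structures.
From mathcomp Require Import all_boot all_order all_algebra.
From mathcomp Require Import all_classical all_reals all_analysis.
From mathcomp Require Import complex.

Set Implicit Arguments.
Unset Strict Implicit.
Unset Printing Implicit Defensive.

Import Order.TTheory GRing.Theory Num.Theory.
Import numFieldNormedType.Exports.

Local Open Scope classical_set_scope.
Local Open Scope ring_scope.

(** * C*-algebras *)

(* The algebras are not assumed unital (C*(G) is not unital in general), so the
   product is added on top of a Banach space instead of coming from MathComp's
   ring structures, which all have a unit.  The zero algebra is allowed.  As
   the scalars are R[i], norms are elements of R[i] (nonnegative reals). *)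
HB.mixin Record CompleteNormedModule_isCStarAlgebra (R : realType) A
    of CompleteNormedModule R[i] A := {
  cmul : A -> A -> A ;
  star : A -> A ;
  cmulA : associative cmul ;
  cmulDl : left_distributive cmul +%R ;
  cmulDr : right_distributive cmul +%R ;
  cmulZl : forall (c : R[i]) (x y : A), cmul (c *: x) y = c *: cmul x y ;
  cmulZr : forall (c : R[i]) (x y : A), cmul x (c *: y) = c *: cmul x y ;
  starK : involutive star ;
  starD : {morph star : x y / x + y} ;
  starZ : forall (c : R[i]) (x : A), star (c *: x) = c^* *: star x ;
  starM : forall x y : A, star (cmul x y) = cmul (star y) (star x) ;
  norm_cmul_le : forall x y : A, `|cmul x y| <= `|x| * `|y| ;
  cstar_identity : forall x : A, `|cmul (star x) x| = `|x| ^+ 2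
}.

#[short(type="cstarAlgType")]
HB.structure Definition CStarAlgebra (R : realType) :=
  { A of CompleteNormedModule_isCStarAlgebra R A & CompleteNormedModule R[i] A }.

Notation "x ** y" := (cmul x y) (at level 40, left associativity) : ring_scope.

Section CStarAlgebraTheory.
Variable R : realType.
Implicit Types A B : cstarAlgType R.

Definition projection A (p : A) : Prop := p ** p = p /\ star p = p.

Definition partial_isometry A (s : A) : Prop := s ** star s ** s = s.

(* The usual order on projections. *)
Definition proj_le A (p q : A) : Prop := p ** q = p.

Definition star_subalgebra A (S : set A) : Prop :=
  [/\ S 0,
      forall (c : R[i]) x y, S x -> S y -> S (c *: x + y),
      forall x y, S x -> S y -> S (x ** y)
    & forall x, S x -> S (star x)].

Definition generated_cstar_subalgebra A (X : set A) : set A :=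
  smallest (fun S => star_subalgebra S /\ closed S) X.

Definition star_morphism A B (f : {linear A -> B}) : Prop :=
  {morph f : x y / x ** y} /\ {morph f : x / star x}.

Definition finite_dimensional A (S : set A) : Prop :=
  exists (n : nat) (b : 'I_n -> A),
    S = [set x | exists c : 'I_n -> R[i], x = \sum_(i < n) c i *: b i].

Definition AF A : Prop :=
  exists F : nat -> set A,
    [/\ forall n, star_subalgebra (F n) /\ finite_dimensional (F n),
        forall n, F n `<=` F n.+1
      & closure (\bigcup_n F n) = setT].

End CStarAlgebraTheory.

(** * Ultragraphs *)

Record ultragraph := Ultragraph {
  vertex : countType ;
  edge : countType ;
  src : edge -> vertex ;
  rng : edge -> set vertex ;
  rng_nonempty : forall e, rng e !=set0
}.

(* The collection written \mathcal{G}^0, with the empty set included. *)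
Definition gen_vertex_sets (G : ultragraph) : set (set (vertex G)) :=
  smallest (fun M => [/\ M set0, setI_closed M & setU_closed M])
    ([set [set v] | v in setT] `|` range (@rng G)).

Definition is_loop (G : ultragraph) (a : seq (edge G)) : Prop :=
  a <> [::] /\ cycle (fun e f => src f \in rng e) a.

(** * Cuntz-Krieger families and the C*-algebra of an ultragraph *)

Section CuntzKrieger.
Variables (R : realType) (G : ultragraph).

(* The projections are given by a total function on sets of vertices; its values
   outside [gen_vertex_sets G] are irrelevant and never used. *)
Record CK_family (A : cstarAlgType R)
    (s : edge G -> A) (p : set (vertex G) -> A) : Prop := {
  CK_partial_isometry : forall e, partial_isometry (s e) ;
  CK_orthogonal_ranges : forall e f, e <> f ->
    (s e ** star (s e)) ** (s f ** star (s f)) = 0 ;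
  CK_projection : forall X, gen_vertex_sets X -> projection (p X) ;
  CK_set0 : p set0 = 0 ;
  CK_setI : forall X Y, gen_vertex_sets X -> gen_vertex_sets Y ->
    p X ** p Y = p (X `&` Y) ;
  CK_setU : forall X Y, gen_vertex_sets X -> gen_vertex_sets Y ->
    p (X `|` Y) = p X + p Y - p (X `&` Y) ;
  CK_source : forall e, star (s e) ** s e = p (rng e) ;
  CK_range : forall e, proj_le (s e ** star (s e)) (p [set src e]) ;
  CK_vertex : forall v : vertex G,
    finite_set [set e | src e = v] -> [set e | src e = v] !=set0 ->
    p [set v] = \sum_(e \in [set e | src e = v]) (s e ** star (s e))
}.

(* [is_CstarG s p]: the algebra A, together with the family (s, p), is C*(G).
   This determines (A, s, p) up to a unique isomorphism. *)
Record is_CstarG (A : cstarAlgType R)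
    (s : edge G -> A) (p : set (vertex G) -> A) : Prop := {
  CstarG_family : CK_family s p ;
  CstarG_generated :
    generated_cstar_subalgebra (range s `|` p @` @gen_vertex_sets G) = setT ;
  CstarG_universal : forall (B : cstarAlgType R)
      (t : edge G -> B) (q : set (vertex G) -> B), CK_family t q ->
    exists f : {linear A -> B},
      [/\ star_morphism f, forall e, f (s e) = t e
        & forall X, gen_vertex_sets X -> f (p X) = q X]
}.

End CuntzKrieger.

(* Main.v *)
Require Import Defs.
From HB Require Import structures.
From mathcomp Require Import all_boot all_order all_algebra.
From mathcomp Require Import all_classical all_reals all_analysis.
From mathcomp Require Import complex.
From mathcomp Require Import ring lra.

(** Suppose first that there are no loops. The algebra is spanned, up to closure,
    by the monomials [s_al p_Y s_be^*] with [al], [be] words of edges. A word over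
    a finite list of edges vanishes unless it is a path, and a path longer than
    the list repeats an edge and hence contains a loop; so only finitely many
    nonzero monomials use a given finite stock of edges and vertex sets
    ([long_word0]). Their span is a star-subalgebra, because the Cuntz-Krieger
    relations turn a generator times a monomial into a monomial or zero. These
    spans increase, and their union is dense ([no_loop_AF]).

    Suppose now that there is a loop [al] based at [v]. The element [s = s_al p_v]
    satisfies [star s ** s = p_v] and [p_v ** s = s]. In an AF algebra it is close
    to elements [t] of finite-dimensional subalgebras, and such a [t] is a root of
    a nonzero polynomial in every representation at once
    ([finite_dim_algebraic]). This is refuted in representations on the square
    summable functions on the space of boundary paths, one for each point [z] of
    the unit circle, in which every edge carries the phase [z] ([gauge_family]).

    If some boundary path from [v] does not begin with [al], then [s + 1 - p_v] is
    an isometry whose range is not dense. It is close to [1 + g] with [g] algebraic,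
    which is therefore injective; for an algebraic operator this implies
    surjectivity, which in turn forces the range of the isometry to be dense
    ([AF_isometry_dense_range], [AF_starts_with]).

    Otherwise [al] repeated forever is the only boundary path from [v]
    ([loop_path_unique]), and [s] is represented by [z ^ n] times a projection of
    rank one, where [n] is the length of [al]. The operator of [t] then has exactly
    one large eigenvalue; it is within [1 / 8] of [z ^ n] and varies continuously
    with [z] ([near_rank_one_eigen], [normal_eigenvector_stable]). It is also a
    root of a polynomial that does not depend on [z], so it is constant, whereas
    [z ^ n] runs from [1] to [- 1] on an arc of the circle ([loop_not_AF]).

    The universal property is applied to the C*-algebra of bounded adjointable
    operators on a Hilbert space, which is constructed below. Approximations in
    the algebra carry over to operators because representations are contractive
    ([rnorm_morph]). *)

Set Implicit Arguments.
Unset Strict Implicit.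
Unset Printing Implicit Defensive.

Import Order.TTheory GRing.Theory Num.Theory.
Import numFieldNormedType.Exports.

Local Open Scope classical_set_scope.
Local Open Scope complex_scope.
Local Open Scope ring_scope.

Local Notation Re := complex.Re.
Local Notation Im := complex.Im.

(** * Real-valued norms *)

Section RealNorm.
Variable R : realType.

(** Norms are elements of [R[i]]; their real parts are the same numbers in the
    totally ordered field [R]. *)
Definition rnorm (V : normedZmodType R[i]) (x : V) : R := Re `|x|.

Section Normed.
Variable V : normedZmodType R[i].
Implicit Types x y : V.

Lemma rnormE x : `|x| = (rnorm x)%:C.
Proof. by rewrite /rnorm RRe_real ?normr_real. Qed.

Lemma rnorm_ge0 x : 0 <= rnorm x.
Proof. by rewrite -ler0c -rnormE. Qed.

Lemma rnormD x y : rnorm (x + y) <= rnorm x + rnorm y.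
Proof. by rewrite -lecR rmorphD /= -!rnormE ler_normD. Qed.

Lemma rnormN x : rnorm (- x) = rnorm x.
Proof. by rewrite /rnorm normrN. Qed.

Lemma rnormB x y : rnorm (x - y) = rnorm (y - x).
Proof. by rewrite /rnorm distrC. Qed.

Lemma rnorm0 : rnorm (0 : V) = 0.
Proof. by rewrite /rnorm normr0. Qed.

Lemma rnorm_dist x y z : rnorm (x - z) <= rnorm (x - y) + rnorm (y - z).
Proof. by rewrite (_ : x - z = (x - y) + (y - z)) ?rnormD // addrA subrK. Qed.

Lemma rnorm_eq0 x : rnorm x = 0 -> x = 0.
Proof. by move=> x0; apply/eqP; rewrite -normr_eq0 rnormE x0. Qed.

Lemma rnorm_lt x (e : R) : (`|x| < e%:C) = (rnorm x < e).
Proof. by rewrite rnormE ltcR. Qed.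

End Normed.

Lemma rnormZ (V : normedModType R[i]) (c : R[i]) (x : V) :
  rnorm (c *: x) = rnorm c * rnorm x.
Proof. by apply: (@complexI R); rewrite rmorphM /= -!rnormE normrZ. Qed.

Lemma rnormM (c d : R[i]) : rnorm (c * d) = rnorm c * rnorm d.
Proof. by apply: (@complexI R); rewrite rmorphM /= -!rnormE normrM. Qed.

Lemma rnormC (r : R) : rnorm (r%:C : R[i]) = `|r|.
Proof.
by rewrite /rnorm normc_def /= expr0n /= addr0 sqrtr_sqr.
Qed.

Lemma rnorm1 : rnorm (1 : R[i]) = 1.
Proof. by rewrite /rnorm normr1. Qed.

Lemma rnormX (c : R[i]) n : rnorm (c ^+ n) = rnorm c ^+ n.
Proof. by elim: n => [|n IH]; rewrite ?rnorm1 // !exprS rnormM IH. Qed.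

Lemma sqr_rnorm (c : R[i]) : rnorm c ^+ 2 = Re c ^+ 2 + Im c ^+ 2.
Proof.
by rewrite /rnorm normc_def /= sqr_sqrtr // addr_ge0 // sqr_ge0.
Qed.

Lemma mul_conj_rnorm (c : R[i]) : c * Num.conj c = (rnorm c ^+ 2)%:C.
Proof. by rewrite -normCK rnormE rmorphXn. Qed.

Lemma Re_le_rnorm (c : R[i]) : `|Re c| <= rnorm c.
Proof. by rewrite -lecR -rnormE normc_ge_Re. Qed.

Lemma rnorm_le_ReIm (c : R[i]) : rnorm c <= `|Re c| + `|Im c|.
Proof.
rewrite -(@ler_pXn2r _ 2) ?nnegrE ?rnorm_ge0 ?addr_ge0 //.
rewrite sqr_rnorm sqrrD !real_normK ?num_real // lerD2r lerDl.
by rewrite mulrn_wge0 // mulr_ge0.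
Qed.

End RealNorm.

(** * Cauchy sequences *)

Section Cauchy.
Variable R : realType.

Definition cauchy_dist (d : nat -> nat -> R) : Prop :=
  forall e, 0 < e -> exists N, forall m n, (N <= m)%N -> (N <= n)%N -> d m n < e.

(** Meant for nonnegative sequences, hence one-sided. *)
Definition null_seq (u : nat -> R) : Prop :=
  forall e, 0 < e -> exists N, forall n, (N <= n)%N -> u n < e.

Lemma geometric_null (M q : R) : 0 <= M -> 0 <= q -> q < 1 ->
  null_seq (fun n => M * q ^+ n).
Proof.
move=> M0 q0 q1 e e0.
have /cvgrPdist_lt : (geometric M q @ \oo --> (0 : R)).
  by apply: cvg_geometric; rewrite ger0_norm.
move=> /(_ e e0)[N _ HN]; exists N => n Nn.
have := HN n Nn; rewrite sub0r normrN /geometric /=.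
by rewrite ger0_norm // mulr_ge0 // exprn_ge0.
Qed.

Lemma geometric_cauchy (V : normedZmodType R[i]) (u : nat -> V) (M q : R) :
  0 <= M -> 0 <= q -> q < 1 ->
  (forall n, rnorm (u n.+1 - u n) <= M * q ^+ n) ->
  cauchy_dist (fun m n => rnorm (u m - u n)).
Proof.
move=> M0 q0 q1 Hu.
have q1' : 0 < 1 - q by rewrite subr_gt0.
pose D := M / (1 - q).
have D0 : 0 <= D by rewrite divr_ge0 // ltW.
have DE : D * (1 - q) = M by rewrite /D mulfVK // gt_eqF.
have H n k : rnorm (u (n + k)%N - u n) <= D * (q ^+ n - q ^+ (n + k)).
  elim: k => [|k IH]; first by rewrite addn0 !subrr rnorm0 mulr0.
  apply: le_trans (rnorm_dist _ (u (n + k)%N) _) _.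
  rewrite addnS; apply: le_trans (lerD (Hu _) IH) _.
  rewrite -DE exprS -subr_ge0.
  by rewrite (_ : _ - _ = 0) //; ring.
move=> e e0.
have [N HN] := geometric_null D0 q0 q1 (divr_gt0 e0 (ltr0n _ 2)).
have K m : (N <= m)%N -> rnorm (u m - u N) < e / 2.
  move=> Nm; rewrite -(subnKC Nm); apply: le_lt_trans (H _ _) _.
  apply: le_lt_trans (HN N (leqnn _)).
  by rewrite ler_wpM2l // gerBl exprn_ge0.
exists N => m n Nm Nn; apply: le_lt_trans (rnorm_dist _ (u N) _) _.
by rewrite [e]splitr ltrD ?K // rnormB K.
Qed.

Lemma cauchy_limit (V : completeNormedModType R[i]) (u : nat -> V) :
  cauchy_dist (fun m n => rnorm (u m - u n)) ->
  exists l, null_seq (fun n => rnorm (u n - l)).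
Proof.
move=> Hu.
have : cvg (u @ \oo).
  apply/cauchy_cvgP/cauchy_ballP => e e0; near_simpl.
  have [r re] : exists r : R, e = r%:C.
    by exists (Re e); rewrite RRe_real // gtr0_real.
  move: e0; rewrite re -(rmorph0 (real_complex R)) ltcR => r0.
  have [N HN] := Hu r r0.
  exists ([set n | (N <= n)%N], [set n | (N <= n)%N]); first by split; exists N.
  by move=> [m n] [/= Nm Nn]; rewrite -ball_normE /= rnorm_lt HN.
move=> /cvg_ex[l /cvgrPdist_lt Hl]; exists l => e e0.
have [|N _ HN] := Hl e%:C; first by rewrite -(rmorph0 (real_complex R)) ltcR.
by exists N => n Nn; rewrite rnormB -rnorm_lt; exact: HN.
Qed.

(** A Cauchy filter has the same limit as a sequence of centres of balls of radius
    [2 ^- n] that belong to it. *)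
Lemma seq_complete (V : normedModType R[i]) :
  (forall u : nat -> V, cauchy_dist (fun m n => rnorm (u m - u n)) ->
     exists l, null_seq (fun n => rnorm (u n - l))) ->
  forall F : set_system V, ProperFilter F -> cauchy F -> cvg F.
Proof.
move=> seqV F PF Fc.
have h0 n : 0 < 2^-1 ^+ n :> R by rewrite exprn_gt0 // invr_gt0.
have HC (r : R) : 0 < r -> 0 < r%:C :> R[i].
  by rewrite -(rmorph0 (real_complex R)) ltcR.
have /choice[x Hx] n : exists x : V, F (ball x ((2^-1 ^+ n : R)%:C)).
  by have /cauchyP := Fc; apply; exact: HC.
have hn : null_seq (fun n => 1 * 2^-1 ^+ n : R).
  by apply: geometric_null => //; rewrite invf_lt1 // ltr1n.
have [l Hl] : exists l, null_seq (fun n => rnorm (x n - l)).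
  apply: seqV => e e0; have [N HN] := hn _ (divr_gt0 e0 (ltr0n _ 2)).
  exists N => m n Nm Nn.
  have [z [zm zn]] := filter_ex (filterI (Hx m) (Hx n)).
  apply: le_lt_trans (rnorm_dist _ z _) _; rewrite [e]splitr.
  move: zm zn; rewrite -ball_normE /= !rnorm_lt => zm zn.
  rewrite ltrD //; first by apply: lt_trans zm _; rewrite -(mul1r (_ ^+ _)) HN.
  by rewrite rnormB; apply: lt_trans zn _; rewrite -(mul1r (_ ^+ _)) HN.
apply/cvg_ex; exists l; apply/cvgrPdist_lt => e e0.
have [r re] : exists r : R, e = r%:C.
  by exists (Re e); rewrite RRe_real // gtr0_real.
move: e0; rewrite re -(rmorph0 (real_complex R)) ltcR => r0.
have [N HN] := Hl _ (divr_gt0 r0 (ltr0n _ 2)).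
have [N' HN'] := hn _ (divr_gt0 r0 (ltr0n _ 2)).
pose n := maxn N N'.
apply: filterS (Hx n) => z; rewrite -ball_normE /= !rnorm_lt => zn.
rewrite rnormB; apply: le_lt_trans (rnorm_dist _ (x n) _) _; rewrite [r]splitr.
rewrite ltrD ?HN ?leq_maxl // rnormB; apply: lt_trans zn _.
by rewrite -(mul1r (_ ^+ _)) HN' // leq_maxr.
Qed.

Lemma closure_rnorm (V : normedModType R[i]) (S : set V) (x : V) (e : R) :
  closure S x -> 0 < e -> exists2 y, S y & rnorm (x - y) < e.
Proof.
move=> clx e0; have e1 : 0 < e%:C :> R[i].
  by rewrite -(rmorph0 (real_complex R)) ltcR.
have [y [Sy]] := clx _ (nbhsx_ballx x _ e1).
by rewrite -ball_normE /= rnorm_lt => xy; exists y.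
Qed.

End Cauchy.

(** * Hilbert spaces *)

(** The inner product is the real part of the usual one; [dotZ] then says that
    multiplication by [c] has adjoint multiplication by the conjugate of [c]. *)
Record hilbert (R : realType) := Hilbert {
  hcar :> lmodType R[i] ;
  dot : hcar -> hcar -> R ;
  dotC : forall x y, dot x y = dot y x ;
  dotDl : forall x y z, dot (x + y) z = dot x z + dot y z ;
  dotZ : forall c x y, dot (c *: x) y = dot x (Num.conj c *: y) ;
  dotZl : forall r x y, dot (r%:C *: x) y = r * dot x y ;
  dot_gt0 : forall x, x != 0 -> 0 < dot x x ;
  hilbert_complete : forall u : nat -> hcar,
    cauchy_dist (fun m n => dot (u m - u n) (u m - u n)) ->
    exists l, null_seq (fun n => dot (u n - l) (u n - l))
}.

Section HilbertTheory.
Variables (R : realType) (H : hilbert R).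
Implicit Types (x y z : H) (r : R) (c : R[i]).

Definition hnorm x : R := Num.sqrt (dot x x).

Lemma dotDr x y z : dot x (y + z) = dot x y + dot x z.
Proof. by rewrite dotC dotDl !(dotC x). Qed.

Lemma dotZr r x y : dot x (r%:C *: y) = r * dot x y.
Proof. by rewrite dotC dotZl dotC. Qed.

Lemma dotNl x y : dot (- x) y = - dot x y.
Proof.
by rewrite -scaleN1r -(rmorph1 (real_complex R)) -rmorphN dotZl mulN1r.
Qed.

Lemma dotNr x y : dot x (- y) = - dot x y.
Proof. by rewrite dotC dotNl dotC. Qed.

Lemma dot0l x : dot 0 x = 0.
Proof. by apply: (addrI (dot 0 x)); rewrite -dotDl !addr0. Qed.

Lemma dot_ge0 x : 0 <= dot x x.
Proof. by have [->|/dot_gt0/ltW//] := eqVneq x 0; rewrite dot0l. Qed.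

Lemma dot_eq0 x : dot x x = 0 -> x = 0.
Proof.
by have [//|/dot_gt0 x0 x1] := eqVneq x 0; rewrite x1 ltxx in x0.
Qed.

Lemma eq_dot x y : (forall z, dot z x = dot z y) -> x = y.
Proof.
move=> xy; apply: subr0_eq; apply: dot_eq0.
by rewrite dotDr dotNr xy subrr.
Qed.

Lemma hnorm_ge0 x : 0 <= hnorm x. Proof. exact: sqrtr_ge0. Qed.

Lemma hnorm_sqr x : hnorm x ^+ 2 = dot x x.
Proof. by rewrite sqr_sqrtr // dot_ge0. Qed.

Lemma hnorm0 : hnorm (0 : H) = 0.
Proof. by rewrite /hnorm dot0l sqrtr0. Qed.

Lemma hnorm_eq0 x : hnorm x = 0 -> x = 0.
Proof. by move=> x0; apply: dot_eq0; rewrite -hnorm_sqr x0 expr0n. Qed.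

Lemma dot_le_hnorm x y : dot x y <= hnorm x * hnorm y.
Proof.
have [->|y0] := eqVneq y 0; first by rewrite dotC dot0l hnorm0 mulr0.
have yy := dot_gt0 y0.
rewrite -sqrtrM ?dot_ge0 //; apply: le_trans (ler_norm _) _.
rewrite -sqrtr_sqr ler_sqrt ?mulr_ge0 ?dot_ge0 //.
have := dot_ge0 (x - (dot x y / dot y y)%:C *: y).
rewrite dotDl !dotDr !dotNl !dotNr !dotZl !dotZr (dotC y x) opprK.
set t := dot x y / dot y y; have <- : t * dot y y = dot x y.
  by rewrite /t mulfVK // gt_eqF.
move=> h; rewrite -subr_ge0.
have -> : dot x x * dot y y - (t * dot y y) ^+ 2
  = (dot x x - t * (t * dot y y) + (- (t * (t * dot y y)) + t * (t * dot y y)))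
    * dot y y by ring.
by rewrite mulr_ge0 // ltW.
Qed.

Lemma norm_dot_le x y : `|dot x y| <= hnorm x * hnorm y.
Proof.
rewrite ler_norml dot_le_hnorm andbT lerNl -dotNl /hnorm.
by rewrite -(opprK (dot x x)) -dotNl -dotNr dot_le_hnorm.
Qed.

Lemma hnorm_le x r : 0 <= r -> dot x x <= r ^+ 2 -> hnorm x <= r.
Proof.
by move=> r0 xr; rewrite -(@ler_pXn2r _ 2) ?nnegrE ?hnorm_ge0 // hnorm_sqr.
Qed.

Lemma hnormD x y : hnorm (x + y) <= hnorm x + hnorm y.
Proof.
apply: hnorm_le; first by rewrite addr_ge0 ?hnorm_ge0.
rewrite dotDl !dotDr (dotC y x) -!hnorm_sqr.
by have := dot_le_hnorm x y; lra.
Qed.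

Lemma hnormZ c x : hnorm (c *: x) = rnorm c * hnorm x.
Proof.
rewrite /hnorm dotZ scalerA mulrC mul_conj_rnorm dotZr.
by rewrite sqrtrM ?sqr_ge0 // sqrtr_sqr ger0_norm // rnorm_ge0.
Qed.

Lemma hnormN x : hnorm (- x) = hnorm x.
Proof. by rewrite /hnorm dotNl dotNr opprK. Qed.

Lemma hnorm_dist x y z : hnorm (x - z) <= hnorm (x - y) + hnorm (y - z).
Proof. by rewrite (_ : x - z = (x - y) + (y - z)) ?hnormD // addrA subrK. Qed.

Lemma hnorm_limit (u : nat -> H) :
  cauchy_dist (fun m n => hnorm (u m - u n)) ->
  exists l, null_seq (fun n => hnorm (u n - l)).
Proof.
move=> Hu.
have [e e0|l Hl] := @hilbert_complete _ H u.
  have [|N HN] := Hu (Num.sqrt e); first by rewrite sqrtr_gt0.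
  by exists N => m n Nm Nn; have := HN m n Nm Nn; rewrite ltr_sqrt.
exists l => e e0; have [|N HN] := Hl (e ^+ 2); first by rewrite exprn_gt0.
exists N => n Nn; rewrite -(@ltr_pXn2r _ 2) ?nnegrE ?hnorm_ge0 ?ltW //.
by rewrite hnorm_sqr HN.
Qed.

End HilbertTheory.

(** * The C*-algebra of bounded adjointable operators *)

Section BoundedOperators.
Variables (R : realType) (H : hilbert R).
Implicit Types (x y z : H) (S T : H -> H) (r : R) (c : R[i]).

Definition adjoint T S : Prop := forall x y, dot (T x) y = dot x (S y).

Definition bounded_by r T : Prop := 0 <= r /\ forall x, hnorm (T x) <= r * hnorm x.

(** Linearity does not follow from the existence of an adjoint, which conjugate
    linear maps also have for the real part of the inner product. *)
Definition linear_op T : Prop := forall c x y, T (c *: x + y) = c *: T x + T y.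

Definition bounded_adjointable T : Prop :=
  [/\ linear_op T, exists S, adjoint T S & exists r, bounded_by r T].

Lemma adjoint_sym T S : adjoint T S -> adjoint S T.
Proof. by move=> TS x y; rewrite dotC -TS dotC. Qed.

Lemma adjoint_uniq T S S' : adjoint T S -> adjoint T S' -> S = S'.
Proof.
by move=> TS TS'; apply/funext => x; apply: eq_dot => z; rewrite -TS -TS'.
Qed.

Lemma linear_op0 T : linear_op T -> T 0 = 0.
Proof.
by move=> Tl; apply: (addrI (1 *: T 0)); rewrite -Tl scale1r !addr0 scale1r.
Qed.

Lemma linear_opZ T c x : linear_op T -> T (c *: x) = c *: T x.
Proof. by move=> Tl; rewrite -[c *: x]addr0 Tl linear_op0 // addr0. Qed.

Lemma adjoint_linear T S : linear_op T -> adjoint T S -> linear_op S.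
Proof.
move=> Tlin TS c x y; apply: eq_dot => z.
rewrite -TS !dotDr -TS; congr (_ + _).
by rewrite -{1}(conjCK c) -dotZ -(linear_opZ _ _ Tlin) TS -{2}(conjCK c) -dotZ.
Qed.

Lemma adjoint_bounded T S r : adjoint T S -> bounded_by r T -> bounded_by r S.
Proof.
move=> TS [r0 Tr]; split=> // x.
have [S0|Sx0] := eqVneq (hnorm (S x)) 0.
  by rewrite S0 mulr_ge0 ?hnorm_ge0.
have {}Sx0 : 0 < hnorm (S x) by rewrite lt_def Sx0 hnorm_ge0.
rewrite -(ler_pM2r Sx0) -expr2 hnorm_sqr -TS.
apply: le_trans (dot_le_hnorm _ _) _.
by rewrite mulrAC ler_wpM2r ?hnorm_ge0.
Qed.

Definition bop_pred : {pred H -> H} := fun T => `[< bounded_adjointable T >].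

Lemma bop_pred_submod : submod_closed bop_pred.
Proof.
split=> [|c T T' /asboolP[Tl [S TS] [r [r0 Tr]]] /asboolP[Tl' [S' TS'] [r' [r0' Tr']]]].
  apply/asboolP; split.
  - by move=> c x y; rewrite scaler0 addr0.
  - by exists (fun=> 0) => x y; rewrite dot0l dotC dot0l.
  - by exists 0; split=> // x; rewrite hnorm0 mul0r.
apply/asboolP; split.
- move=> d x y; rewrite /= !fctE /= Tl Tl' !scalerDr !scalerA (mulrC c).
  by rewrite !addrA; congr (_ + _); rewrite -!addrA; congr (_ + _); rewrite addrC.
- exists (fun x => Num.conj c *: S x + S' x) => x y.
  by rewrite /= !fctE /= dotDl dotDr TS' dotZ TS linear_opZ //;
    exact: adjoint_linear TS.
- exists (rnorm c * r + r'); split=> [|x].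
    by rewrite addr_ge0 // mulr_ge0 // rnorm_ge0.
  apply: le_trans (hnormD _ _) _; rewrite mulrDl lerD //.
  by rewrite hnormZ -mulrA ler_wpM2l // rnorm_ge0.
Qed.

End BoundedOperators.


Record bop (R : realType) (H : hilbert R) := Bop {
  bop_fun :> H -> H ;
  _ : bop_pred bop_fun
}.

HB.instance Definition _ (R : realType) (H : hilbert R) :=
  [isSub for @bop_fun R H].
HB.instance Definition _ (R : realType) (H : hilbert R) :=
  [Choice of bop H by <:].
HB.instance Definition _ (R : realType) (H : hilbert R) :=
  GRing.isSubmodClosed.Build _ _ (@bop_pred R H) (@bop_pred_submod R H).
HB.instance Definition _ (R : realType) (H : hilbert R) :=
  [SubChoice_isSubLmodule of bop H by <:].

Section OperatorNorm.
Variables (R : realType) (H : hilbert R).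
Implicit Types (x y z : H) (S T : bop H) (r : R) (c : R[i]).

Lemma bopP T : bounded_adjointable T. Proof. by case: T => T /= /asboolP. Qed.

Definition mk_bop (T : H -> H) (HT : bounded_adjointable T) : bop H :=
  Bop (introT (asboolP _) HT).

Lemma bop_eq S T : (forall x, S x = T x) -> S = T.
Proof. by move=> ST; apply/val_inj/funext. Qed.

Lemma bopD S T x : (S + T) x = S x + T x. Proof. by []. Qed.
Lemma bopN T x : (- T) x = - T x. Proof. by []. Qed.
Lemma bopZ c T x : (c *: T) x = c *: T x. Proof. by []. Qed.
Lemma bop_linear T : linear_op T. Proof. by have [] := bopP T. Qed.

Lemma bop_at0 T : T 0 = 0. Proof. exact: linear_op0 (bop_linear T). Qed.

Lemma bop_atZ T c x : T (c *: x) = c *: T x.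
Proof. exact: linear_opZ (bop_linear T). Qed.

Lemma bop_atD T x y : T (x + y) = T x + T y.
Proof. by have := bop_linear T 1 x y; rewrite !scale1r. Qed.

Lemma bop_atN T x : T (- x) = - T x.
Proof. by rewrite -scaleN1r bop_atZ scaleN1r. Qed.

Definition opnorm T : R := inf [set r | bounded_by r T].

Lemma opnorm_has_inf T : has_inf [set r | bounded_by r T].
Proof.
have [_ _ [r Tr]] := bopP T; split; first by exists r.
by exists 0 => s [].
Qed.

Lemma opnorm_ge0 T : 0 <= opnorm T.
Proof.
have [[r Tr] _] := opnorm_has_inf T.
by apply: lb_le_inf; [exists r | move=> s []].
Qed.

Lemma opnormP T x : hnorm (T x) <= opnorm T * hnorm x.
Proof.
have [x0|x0] := eqVneq (hnorm x) 0.
  by rewrite (hnorm_eq0 x0) bop_at0 hnorm0 mulr0.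
have {}x0 : 0 < hnorm x by rewrite lt_def x0 hnorm_ge0.
have [[r Tr] _] := opnorm_has_inf T.
rewrite -ler_pdivrMr //; apply: lb_le_inf; first by exists r.
by move=> s [_ Ts]; rewrite ler_pdivrMr.
Qed.

Lemma opnorm_le T r : bounded_by r T -> opnorm T <= r.
Proof. by move=> Tr; apply: ge_inf => //; have [] := opnorm_has_inf T. Qed.

Lemma opnorm_bounded T : bounded_by (opnorm T) T.
Proof. by split; [exact: opnorm_ge0 | exact: opnormP]. Qed.

Lemma opnormD S T : opnorm (S + T) <= opnorm S + opnorm T.
Proof.
apply: opnorm_le; split; first by rewrite addr_ge0 ?opnorm_ge0.
by move=> x; rewrite bopD mulrDl (le_trans (hnormD _ _)) // lerD // opnormP.
Qed.

Lemma opnormZ c T : opnorm (c *: T) = rnorm c * opnorm T.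
Proof.
have le d S : opnorm (d *: S) <= rnorm d * opnorm S.
  apply: opnorm_le; split; first by rewrite mulr_ge0 ?opnorm_ge0 ?rnorm_ge0.
  by move=> x; rewrite bopZ hnormZ -mulrA ler_wpM2l ?rnorm_ge0 ?opnormP.
apply/eqP; rewrite eq_le le /=.
have [->|c0] := eqVneq c 0; first by rewrite rnorm0 mul0r opnorm_ge0.
have rc : rnorm c * rnorm c^-1 = 1 by rewrite -rnormM mulfV ?rnorm1.
have c1 : 0 <= rnorm c by exact: rnorm_ge0.
have := ler_wpM2l c1 (le c^-1 (c *: T)).
by rewrite scalerA mulVf // scale1r mulrA rc mul1r.
Qed.

Lemma opnorm_eq0 T : opnorm T = 0 -> T = 0.
Proof.
move=> T0; apply: bop_eq => x; apply: hnorm_eq0; apply/eqP.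
by rewrite eq_le hnorm_ge0 andbT (le_trans (opnormP T x)) // T0 mul0r.
Qed.

Let cnorm T : R[i] := (opnorm T)%:C.

Let cnormD S T : cnorm (S + T) <= cnorm S + cnorm T.
Proof. by rewrite /cnorm -rmorphD lecR opnormD. Qed.

Let cnormZ c T : cnorm (c *: T) = `|c| * cnorm T.
Proof. by rewrite /cnorm opnormZ rmorphM /= -rnormE. Qed.

Let cnorm_eq0 T : cnorm T = 0 -> T = 0.
Proof. by move=> /complexI /opnorm_eq0. Qed.

HB.instance Definition _ := Lmodule_isNormed.Build R[i] (bop H)
  cnormD cnormZ cnorm_eq0.

Lemma rnorm_bop T : rnorm T = opnorm T. Proof. by []. Qed.

End OperatorNorm.

Section NullSequences.
Variable R : realType.
Implicit Types u v : nat -> R.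

Lemma null_seqD u v : null_seq u -> null_seq v -> null_seq (fun n => u n + v n).
Proof.
move=> Hu Hv e e0.
have [N HN] := Hu _ (divr_gt0 e0 (ltr0n _ 2)).
have [N' HN'] := Hv _ (divr_gt0 e0 (ltr0n _ 2)).
exists (maxn N N') => n; rewrite geq_max => /andP[Nn Nn'].
by rewrite [e]splitr ltrD ?HN ?HN'.
Qed.

Lemma null_seqM r u : 0 <= r -> (forall n, 0 <= u n) -> null_seq u ->
  null_seq (fun n => r * u n).
Proof.
move=> r0 u0 Hu e e0.
have r1 : 0 < r + 1 by rewrite ltr_wpDl.
have [N HN] := Hu _ (divr_gt0 e0 r1).
exists N => n Nn; have := HN n Nn; rewrite ltr_pdivlMr // mulrC => h.
by apply: le_lt_trans h; rewrite ler_wpM2r // lerDl.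
Qed.

Lemma null_le u a b N : null_seq u ->
  (forall n, (N <= n)%N -> a <= b + u n) -> a <= b.
Proof.
move=> Hu ab; apply/ler_addgt0Pr => e e0.
have [N' HN'] := Hu _ e0.
apply: le_trans (ab (maxn N N') (leq_maxl _ _)) _.
by rewrite lerD2l ltW // HN' // leq_maxr.
Qed.

End NullSequences.

Section OperatorAlgebra.
Variables (R : realType) (H : hilbert R).
Implicit Types (x y z : H) (S T : bop H) (r : R) (c : R[i]).

Lemma bop_comp_subproof S T : bounded_adjointable (S \o T).
Proof.
have [_ [S' SS'] _] := bopP S; have [_ [T' TT'] _] := bopP T.
split=> [c x y /=||].
- by rewrite !bop_linear.
- by exists (T' \o S') => x y; rewrite /= SS' TT'.
- exists (opnorm S * opnorm T); split=> [|x]; first by rewrite mulr_ge0 ?opnorm_ge0.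
  apply: le_trans (opnormP _ _) _.
  by rewrite -mulrA ler_wpM2l ?opnorm_ge0 ?opnormP.
Qed.

Definition bop_comp S T : bop H := mk_bop (bop_comp_subproof S T).

Lemma bop_star_ex T : exists T' : bop H, adjoint T T'.
Proof.
have [Tl [S TS] [r Tr]] := bopP T.
have HS : bounded_adjointable S.
  split; first exact: adjoint_linear TS.
    by exists T; apply: adjoint_sym.
  by exists r; apply: adjoint_bounded Tr.
by exists (mk_bop HS).
Qed.

Definition bop_star T : bop H := sval (cid (bop_star_ex T)).

Lemma bop_starP T : adjoint T (bop_star T).
Proof. by rewrite /bop_star; case: cid. Qed.

Lemma bop_star_eq T S : adjoint T S -> bop_star T = S.
Proof. by move=> TS; apply/val_inj; exact: (adjoint_uniq (bop_starP T)). Qed.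

Lemma opnorm_comp S T : opnorm (bop_comp S T) <= opnorm S * opnorm T.
Proof.
apply: opnorm_le; split=> [|x /=]; first by rewrite mulr_ge0 ?opnorm_ge0.
apply: le_trans (opnormP _ _) _.
by rewrite -mulrA ler_wpM2l ?opnorm_ge0 ?opnormP.
Qed.

Lemma opnorm_star_le T : opnorm (bop_star T) <= opnorm T.
Proof.
by apply: opnorm_le; apply: adjoint_bounded (bop_starP T) (opnorm_bounded T).
Qed.

Lemma bop_starK : involutive bop_star.
Proof. by move=> T; apply/bop_star_eq/adjoint_sym/bop_starP. Qed.

(** The inequality that is not formal holds because the square of the norm of
    [T x] is the inner product of [bop_star T (T x)] and [x]. *)
Lemma opnorm_cstar T : opnorm (bop_comp (bop_star T) T) = opnorm T ^+ 2.
Proof.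
apply/eqP; rewrite eq_le; apply/andP; split.
  apply: le_trans (opnorm_comp _ _) _.
  by rewrite expr2 ler_wpM2r ?opnorm_ge0 ?opnorm_star_le.
set s := opnorm (bop_comp _ _); have s0 : 0 <= s by exact: opnorm_ge0.
rewrite -(sqr_sqrtr s0) ler_pXn2r ?nnegrE ?opnorm_ge0 ?sqrtr_ge0 //.
apply: opnorm_le; split=> [|x]; first exact: sqrtr_ge0.
apply: hnorm_le; first by rewrite mulr_ge0 ?sqrtr_ge0 ?hnorm_ge0.
rewrite exprMn sqr_sqrtr // (bop_starP T).
apply: le_trans (dot_le_hnorm _ _) _.
by rewrite mulrC expr2 mulrA ler_wpM2r ?hnorm_ge0 // (opnormP (bop_comp _ _)).
Qed.

(** The pointwise limits of the operators and of their adjoints are adjoint to each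
    other, so that the limit is again in the algebra. *)
Lemma bop_seq_complete (u : nat -> bop H) :
  cauchy_dist (fun m n => rnorm (u m - u n)) ->
  exists l, null_seq (fun n => rnorm (u n - l)).
Proof.
move=> Hu.
have lim_at (v : nat -> bop H) : cauchy_dist (fun m n => rnorm (v m - v n)) ->
    forall x, exists l, null_seq (fun n => hnorm (v n x - l)).
  move=> Hv x; apply: hnorm_limit => e e0.
  have x1 : 0 < hnorm x + 1 by rewrite ltr_wpDl ?hnorm_ge0.
  have [N HN] := Hv _ (divr_gt0 e0 x1).
  exists N => m n Nm Nn; have := HN m n Nm Nn; rewrite rnorm_bop ltr_pdivlMr //.
  apply: le_lt_trans; apply: le_trans (opnormP (v m - v n) x) _.
  by rewrite ler_wpM2l ?opnorm_ge0 ?lerDl.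
have Hu' : cauchy_dist (fun m n => rnorm (bop_star (u m) - bop_star (u n))).
  move=> e e0; have [N HN] := Hu e e0; exists N => m n Nm Nn.
  apply: le_lt_trans (HN m n Nm Nn); rewrite !rnorm_bop.
  suff -> : bop_star (u m) - bop_star (u n) = bop_star (u m - u n).
    exact: opnorm_star_le.
  symmetry; apply: bop_star_eq => x y.
  by rewrite !bopD !bopN dotDl dotDr dotNl dotNr !bop_starP.
have /choice[L HL] := lim_at _ Hu; have /choice[S HS] := lim_at _ Hu'.
have [N1 HN1] := Hu 1 ltr01.
have HLbd : bounded_adjointable L.
  split=> [c x y||].
  - apply: subr0_eq; apply: hnorm_eq0; apply/eqP; rewrite eq_le hnorm_ge0 andbT.
    have h0 z n : 0 <= hnorm (u n z - L z) by exact: hnorm_ge0.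
    apply: (@null_le _ _ _ _ 0%N (null_seqD (HL (c *: x + y))
      (null_seqD (null_seqM (rnorm_ge0 c) (h0 x) (HL x)) (HL y)))) => n _.
    rewrite add0r -hnormZ; set a := u n _ - _; set b := c *: (u n x - _); set d := u n y - _.
    have -> : L (c *: x + y) - (c *: L x + L y) = - a + (b + d).
      rewrite /a /b /d bop_linear scalerBr opprB (addrACA (c *: _)).
      by rewrite -opprD addrA subrK.
    apply: le_trans (hnormD _ _) _; rewrite hnormN lerD2l; exact: hnormD.
  - exists S => x y; apply: subr0_eq; apply/eqP.
    rewrite -normr_le0.
    have h0 z n : 0 <= hnorm (u n z - L z) by exact: hnorm_ge0.
    have h1 z n : 0 <= hnorm (bop_star (u n) z - S z) by exact: hnorm_ge0.
    apply: (@null_le _ _ _ _ 0%N (null_seqD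
      (null_seqM (hnorm_ge0 y) (h0 x) (HL x))
      (null_seqM (hnorm_ge0 x) (h1 y) (HS y)))) => n _.
    have E : dot (L x) y - dot x (S y) =
       - dot (u n x - L x) y + dot x (bop_star (u n) y - S y).
      by rewrite dotDl dotDr dotNl dotNr (bop_starP (u n)); ring.
    rewrite add0r E; apply: le_trans (ler_normD _ _) _; rewrite normrN.
    by rewrite lerD ?norm_dot_le // mulrC norm_dot_le.
  - exists (opnorm (u N1) + 1); split=> [|x]; first by rewrite addr_ge0 ?opnorm_ge0.
    apply: (@null_le _ _ _ _ N1 (HL x)) => n N1n.
    have {1}-> : L x = (u n - u N1) x + u N1 x - (u n x - L x).
      by rewrite bopD bopN subrK opprB addrC subrK.
    apply: le_trans (hnormD _ _) _; rewrite hnormN.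
    apply: lerD => //; apply: le_trans (hnormD _ _) _.
    rewrite mulrDl addrC lerD ?opnormP // (le_trans (opnormP _ _)) //.
    by rewrite ler_wpM2r ?hnorm_ge0 // ltW // -rnorm_bop HN1.
exists (mk_bop HLbd) => e e0; have [N HN] := Hu _ (divr_gt0 e0 (ltr0n _ 2)).
exists N => n Nn; apply: (@le_lt_trans _ _ (e / 2)); last first.
  by rewrite ltr_pdivrMr // ltr_pMr // ltr1n.
rewrite rnorm_bop; apply: opnorm_le; split=> [|x]; first by rewrite divr_ge0 ?ltW.
apply: (@null_le _ _ _ _ N (HL x)) => m Nm.
have -> : (u n - mk_bop HLbd) x = (u n - u m) x + (u m x - L x).
  by rewrite !bopD !bopN addrA subrK.
apply: le_trans (hnormD _ _) _; apply: lerD => //.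
apply: le_trans (opnormP _ _) _.
by rewrite ler_wpM2r ?hnorm_ge0 // ltW // -rnorm_bop HN.
Qed.

HB.instance Definition _ := Uniform_isComplete.Build (bop H)
  (@seq_complete R (bop H) bop_seq_complete).

Let bop_compA : associative bop_comp.
Proof. by move=> S T U; apply: bop_eq. Qed.
Let bop_compDl : left_distributive bop_comp +%R.
Proof. by move=> S T U; apply: bop_eq. Qed.
Let bop_compDr : right_distributive bop_comp +%R.
Proof. by move=> S T U; apply: bop_eq => x; rewrite /= bop_atD. Qed.
Let bop_compZl c S T : bop_comp (c *: S) T = c *: bop_comp S T.
Proof. exact: bop_eq. Qed.
Let bop_compZr c S T : bop_comp S (c *: T) = c *: bop_comp S T.
Proof. by apply: bop_eq => x; rewrite /= bop_atZ. Qed.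
Let bop_starD : {morph bop_star : S T / S + T}.
Proof.
move=> S T; apply: bop_star_eq => x y.
by rewrite !bopD dotDl dotDr !bop_starP.
Qed.
Let bop_starZ c T : bop_star (c *: T) = Num.conj c *: bop_star T.
Proof.
apply: bop_star_eq => x y.
by rewrite !bopZ dotZ bop_starP bop_atZ.
Qed.
Let bop_starM S T : bop_star (bop_comp S T) = bop_comp (bop_star T) (bop_star S).
Proof. by apply: bop_star_eq => x y; rewrite /= !bop_starP. Qed.
Let bop_normM S T : `|bop_comp S T| <= `|S| * `|T|.
Proof. by rewrite !rnormE -rmorphM lecR opnorm_comp. Qed.
Let bop_cstar T : `|bop_comp (bop_star T) T| = `|T| ^+ 2.
Proof. by rewrite !rnormE -rmorphXn /= !rnorm_bop opnorm_cstar. Qed.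

HB.instance Definition _ := CompleteNormedModule_isCStarAlgebra.Build R (bop H)
  bop_compA bop_compDl bop_compDr bop_compZl bop_compZr bop_starK bop_starD
  bop_starZ bop_starM bop_normM bop_cstar.

Lemma bopM S T x : (S ** T) x = S (T x). Proof. by []. Qed.

Lemma bop_adj T : adjoint T (star T). Proof. exact: bop_starP. Qed.

Lemma star_bop T S : adjoint T S -> star T = S. Proof. exact: bop_star_eq. Qed.

End OperatorAlgebra.

(** * The Hilbert space of square-summable functions *)

Section SquareSummable.
Variables (R : realType) (X : choiceType).
Implicit Types (f g : X -> R) (u v : X -> R[i]) (c : R[i]) (r : R).

Definition sqn c : R := Re c ^+ 2 + Im c ^+ 2.

Lemma sqn_ge0 c : 0 <= sqn c. Proof. by rewrite addr_ge0 // sqr_ge0. Qed.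

Lemma sqn_rnorm c : sqn c = rnorm c ^+ 2. Proof. by rewrite sqr_rnorm. Qed.

Lemma sqn0 : sqn 0 = 0. Proof. by rewrite /sqn /= expr0n addr0. Qed.

Lemma sqn_eq0 c : sqn c = 0 -> c = 0.
Proof.
rewrite sqn_rnorm => /eqP; rewrite sqrf_eq0 => /eqP; exact: rnorm_eq0.
Qed.

Lemma sqnM c d : sqn (c * d) = sqn c * sqn d.
Proof. by rewrite !sqn_rnorm rnormM exprMn. Qed.

Lemma sqnN c : sqn (- c) = sqn c.
Proof. by rewrite !sqn_rnorm rnormN. Qed.

Lemma sqnD_le c d : sqn (c + d) <= 2 * sqn c + 2 * sqn d.
Proof.
case: c d => [a b] [a' b']; rewrite /sqn /= -subr_ge0.
have -> : 2 * (a ^+ 2 + b ^+ 2) + 2 * (a' ^+ 2 + b' ^+ 2) -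
  ((a + a') ^+ 2 + (b + b') ^+ 2) = (a - a') ^+ 2 + (b - b') ^+ 2 by ring.
by rewrite addr_ge0 // sqr_ge0.
Qed.

Definition etot f : \bar R := \esum_(x in [set: X]) (f x)%:E.

Definition tot f : R := fine (etot f).

Definition nnsummable f : Prop := (forall x, 0 <= f x) /\ (etot f < +oo)%E.

Lemma etot_ge0 f : (forall x, 0 <= f x) -> (0 <= etot f)%E.
Proof. by move=> f0; apply: esum_ge0 => x _; rewrite lee_fin. Qed.

Lemma totE f : nnsummable f -> etot f = (tot f)%:E.
Proof. by move=> [f0 fy]; rewrite fineK // ge0_fin_numE // etot_ge0. Qed.

Lemma tot_ge0 f : nnsummable f -> 0 <= tot f.
Proof. by move=> fs; rewrite -lee_fin -totE // etot_ge0 //; case: fs. Qed.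

Lemma nnsummableD f g : nnsummable f -> nnsummable g ->
  nnsummable (fun x => f x + g x) /\ tot (fun x => f x + g x) = tot f + tot g.
Proof.
move=> fs gs; have [f0 fy] := fs; have [g0 gy] := gs.
have E : etot (fun x => f x + g x) = (etot f + etot g)%E.
  rewrite /etot -esumD; last 2 first.
    by move=> x _; rewrite lee_fin.
    by move=> x _; rewrite lee_fin.
  by apply: eq_esum => x _; rewrite EFinD.
split; last by rewrite {1}/tot E (totE fs) (totE gs).
by split=> [x|]; [rewrite addr_ge0 | rewrite E (totE fs) (totE gs) ltry].
Qed.

(** A sum of nonnegative terms is the supremum of its finite partial sums; this
    lemma and [sum_le_tot] are the two halves. *)
Lemma etot_le_fin f r :
  (forall s : seq X, uniq s -> \sum_(x <- s) f x <= r) -> (etot f <= r%:E)%E.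
Proof.
move=> fr; apply: ge_ereal_sup => _ [A [finA _] <-].
rewrite fsbig_finite //= sumEFin lee_fin; apply: fr; exact: finmap.fset_uniq.
Qed.

Lemma sum_le_tot f (s : seq X) : nnsummable f -> uniq s ->
  \sum_(x <- s) f x <= tot f.
Proof.
move=> fs us; rewrite -lee_fin -totE // -sumEFin.
apply: esum_ge; exists [set` s]; last by rewrite -fsbig_seq.
by split=> //; exact: finite_seq.
Qed.

Lemma nnsummable_le f g : (forall x, 0 <= f x) -> (forall x, f x <= g x) ->
  nnsummable g -> nnsummable f /\ tot f <= tot g.
Proof.
move=> f0 fg gs.
have le : (etot f <= (tot g)%:E)%E.
  by rewrite -totE //; apply: le_esum => x _; rewrite lee_fin.
have fs : nnsummable f by split=> //; apply: le_lt_trans le (ltry _).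
by split=> //; rewrite -lee_fin -totE.
Qed.

Lemma nnsummableZ r f : 0 <= r -> nnsummable f ->
  nnsummable (fun x => r * f x) /\ tot (fun x => r * f x) = r * tot f.
Proof.
have le r' f' : 0 <= r' -> nnsummable f' ->
    nnsummable (fun x => r' * f' x) /\ tot (fun x => r' * f' x) <= r' * tot f'.
  move=> r0 fs; have [f0 _] := fs.
  have h : (etot (fun x => r' * f' x)%R <= (r' * tot f')%:E)%E.
    apply: etot_le_fin => s us; rewrite -mulr_sumr ler_wpM2l //.
    exact: sum_le_tot.
  have fs' : nnsummable (fun x => r' * f' x).
    by split=> [x|]; [rewrite mulr_ge0 | apply: le_lt_trans h (ltry _)].
  by split=> //; rewrite -lee_fin -totE.
move=> r0 fs; have [rfs rfle] := le _ _ r0 fs; split=> //.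
apply/eqP; rewrite eq_le rfle /=.
have [->|rn0] := eqVneq r 0; first by rewrite mul0r tot_ge0 // -[X in nnsummable X]
  /(fun x => 0 * f x); have [] := le 0 f (lexx 0) fs.
have [_] := le r^-1 _ (ltac:(by rewrite invr_ge0)) rfs.
have -> : (fun x => r^-1 * (r * f x)) = f by apply/funext => x; rewrite mulKf.
by move=> h; have := ler_wpM2l r0 h; rewrite mulVKf.
Qed.

Definition l2_pred : {pred X -> R[i]} :=
  fun u => `[< nnsummable (fun x => sqn (u x)) >].

Lemma l2_predP u : reflect (nnsummable (fun x => sqn (u x))) (l2_pred u).
Proof. exact: asboolP. Qed.

Lemma l2_pred_submod : submod_closed l2_pred.
Proof.
split=> [|c u v /l2_predP us /l2_predP vs]; apply/l2_predP.
  split=> [x|]; first exact: sqn_ge0.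
  by rewrite /etot esum1 // => x _; rewrite sqn0.
have [us' _] := nnsummableZ (mulr_ge0 (ler0n R 2) (sqn_ge0 c)) us.
have [vs' _] := nnsummableZ (ler0n R 2) vs.
have [uvs _] := nnsummableD us' vs'.
have [|x|//] := @nnsummable_le (fun x => sqn ((c *: u + v) x)) _ _ _ uvs.
  by move=> x; exact: sqn_ge0.
rewrite !fctE /=; apply: le_trans (sqnD_le _ _) _.
by rewrite -[c *: u x]/(c * u x) sqnM mulrA.
Qed.

End SquareSummable.

Record l2 (R : realType) (X : choiceType) := L2 {
  l2_fun :> X -> R[i] ;
  _ : l2_pred l2_fun
}.

HB.instance Definition _ (R : realType) (X : choiceType) :=
  [isSub for @l2_fun R X].
HB.instance Definition _ (R : realType) (X : choiceType) :=
  [Choice of l2 R X by <:].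
HB.instance Definition _ (R : realType) (X : choiceType) :=
  GRing.isSubmodClosed.Build _ _ (@l2_pred R X) (@l2_pred_submod R X).
HB.instance Definition _ (R : realType) (X : choiceType) :=
  [SubChoice_isSubLmodule of l2 R X by <:].

Section L2Hilbert.
Variables (R : realType) (X : choiceType).
Implicit Types (u v w : l2 R X) (c : R[i]) (r : R).

Lemma l2_eq u v : (forall x, u x = v x) -> u = v.
Proof. by move=> uv; apply/val_inj/funext. Qed.

Lemma l2D u v x : (u + v) x = u x + v x. Proof. by []. Qed.
Lemma l2N u x : (- u) x = - u x. Proof. by []. Qed.
Lemma l2Z c u x : (c *: u) x = c * u x. Proof. by []. Qed.
Lemma l20 x : (0 : l2 R X) x = 0. Proof. by []. Qed.

Lemma l2_summable u : nnsummable (fun x => sqn (u x)).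
Proof. by case: u => u /= /l2_predP. Qed.

Definition sqtot u : R := tot (fun x => sqn (u x)).

Lemma sqtot_identity2 (a b c d : l2 R X) :
  (forall x, sqn (a x) + sqn (b x) = sqn (c x) + sqn (d x)) ->
  sqtot a + sqtot b = sqtot c + sqtot d.
Proof.
move=> abcd; have [_ <-] := nnsummableD (l2_summable a) (l2_summable b).
have [_ <-] := nnsummableD (l2_summable c) (l2_summable d).
by congr tot; apply/funext.
Qed.

Lemma sqtot_identity3 (a b c a' b' c' : l2 R X) :
  (forall x, sqn (a x) + sqn (b x) + sqn (c x) =
             sqn (a' x) + sqn (b' x) + sqn (c' x)) ->
  sqtot a + sqtot b + sqtot c = sqtot a' + sqtot b' + sqtot c'.
Proof.
move=> E; have [ab <-] := nnsummableD (l2_summable a) (l2_summable b).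
have [_ <-] := nnsummableD ab (l2_summable c).
have [ab' <-] := nnsummableD (l2_summable a') (l2_summable b').
have [_ <-] := nnsummableD ab' (l2_summable c').
by congr tot; apply/funext.
Qed.

Lemma sqtotN u : sqtot (- u) = sqtot u.
Proof. by congr tot; apply/funext => x; rewrite l2N sqnN. Qed.

(** Polarization turns the infinite sums of an inner product into sums of
    nonnegative terms, so that its algebraic laws are finite identities. *)
Definition l2_dot u v : R := (sqtot (u + v) - sqtot (u - v)) / 4.

Lemma l2_dotC u v : l2_dot u v = l2_dot v u.
Proof. by rewrite /l2_dot (addrC v u) -(sqtotN (v - u)) opprB. Qed.

Lemma l2_dotDl u v w : l2_dot (u + v) w = l2_dot u w + l2_dot v w.
Proof.
have := @sqtot_identity3 (u + v + w) (u - w) (v - w) (u + v - w) (u + w) (v + w).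
rewrite /l2_dot -mulrDl => E; congr (_ / _); rewrite -[LHS]addr0.
apply/eqP; rewrite -subr_eq0; apply/eqP.
suff /E : forall x, sqn ((u + v + w) x) + sqn ((u - w) x) + sqn ((v - w) x) =
  sqn ((u + v - w) x) + sqn ((u + w) x) + sqn ((v + w) x) by lra.
move=> x; rewrite !l2D !l2N.
by case: (u x) (v x) (w x) => [a b] [a' b'] [a'' b'']; rewrite /sqn /=; ring.
Qed.

Lemma l2_dotZ c u v : l2_dot (c *: u) v = l2_dot u (Num.conj c *: v).
Proof.
have E := @sqtot_identity2 (c *: u + v) (u - Num.conj c *: v)
  (c *: u - v) (u + Num.conj c *: v).
rewrite /l2_dot; congr (_ / _).
suff /E : forall x, sqn ((c *: u + v) x) + sqn ((u - Num.conj c *: v) x) =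
  sqn ((c *: u - v) x) + sqn ((u + Num.conj c *: v) x) by lra.
move=> x; rewrite !l2D !l2N !l2Z.
by case: c (u x) (v x) {E} => [a b] [a' b'] [a'' b'']; rewrite /sqn /=; ring.
Qed.

Lemma l2_dotNl u v : l2_dot (- u) v = - l2_dot u v.
Proof.
rewrite /l2_dot -(sqtotN (- u + v)) -(sqtotN (- u - v)) !opprD !opprK.
by rewrite -mulNr opprB.
Qed.

Lemma l2_dotZl r u v : l2_dot (r%:C *: u) v = r * l2_dot u v.
Proof.
wlog r0 : r u / 0 <= r.
  move=> W; have [/W //|rN] := lerP 0 r.
  have -> : r%:C *: u = (- r)%:C *: (- u) by rewrite rmorphN scalerN scaleNr opprK.
  by rewrite W ?oppr_ge0 ?ltW // l2_dotNl mulrNN.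
rewrite /l2_dot mulrA; congr (_ / _).
have [s1 t1] := nnsummableZ r0 (l2_summable (u - v)).
have [s2 t2] := nnsummableZ r0 (l2_summable (u + v)).
have [_ t3] := nnsummableD (l2_summable (r%:C *: u + v)) s1.
have [_ t4] := nnsummableD (l2_summable (r%:C *: u - v)) s2.
have : tot (fun x => sqn ((r%:C *: u + v) x) + r * sqn ((u - v) x)) =
       tot (fun x => sqn ((r%:C *: u - v) x) + r * sqn ((u + v) x)).
  congr tot; apply/funext => x; rewrite !l2D !l2N !l2Z.
  by case: (u x) (v x) => [a' b'] [a'' b'']; rewrite /sqn /=; ring.
by rewrite t3 t4 t1 t2 -!/(sqtot _) => E; rewrite mulrBr; lra.
Qed.

Lemma l2_dot_self u : l2_dot u u = sqtot u.
Proof.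
rewrite /l2_dot subrr.
have -> : sqtot 0 = 0.
  rewrite /sqtot /tot /etot esum1 // => x _; by rewrite l20 sqn0.
have [_] := nnsummableZ (ler0n R 4) (l2_summable u).
have -> : (fun x => 4 * sqn (u x)) = (fun x => sqn ((u + u) x)).
  apply/funext => x; rewrite l2D; case: (u x) => a b; rewrite /sqn /=; ring.
by rewrite -/(sqtot (u + u)) subr0 => ->; rewrite mulrC mulKf // pnatr_eq0.
Qed.

Lemma sqn_le_sqtot u x : sqn (u x) <= sqtot u.
Proof.
by have := @sum_le_tot _ _ _ [:: x] (l2_summable u) isT; rewrite big_seq1.
Qed.

Lemma l2_dot_gt0 u : u != 0 -> 0 < l2_dot u u.
Proof.
move=> u0; rewrite l2_dot_self lt_def tot_ge0 ?andbT; last exact: l2_summable.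
apply: contra u0 => /eqP u0; apply/eqP/l2_eq => x; apply: sqn_eq0.
by apply/eqP; rewrite eq_le sqn_ge0 andbT -u0 sqn_le_sqtot.
Qed.

End L2Hilbert.

Section L2Complete.
Variables (R : realType) (X : choiceType).
Implicit Types (u v w : l2 R X) (c : R[i]) (r : R).

Lemma real_cauchy_limit (a : nat -> R) :
  (forall e, 0 < e -> exists N, forall m n, (N <= m)%N -> (N <= n)%N ->
     `|a m - a n| < e) ->
  exists l, null_seq (fun n => `|a n - l|).
Proof.
move=> Ha.
have : cvg (a @ \oo).
  apply/cauchy_cvgP/cauchy_ballP => e e0; near_simpl.
  have [N HN] := Ha e e0.
  exists ([set n | (N <= n)%N], [set n | (N <= n)%N]); first by split; exists N.
  by move=> [m n] [/= Nm Nn]; rewrite -ball_normE /= HN.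
move=> /cvg_ex[l /cvgrPdist_lt Hl]; exists l => e /Hl[N _ HN].
by exists N => n Nn; rewrite distrC; exact: HN.
Qed.

Lemma null_seq_sqr (a : nat -> R) :
  null_seq (fun n => `|a n|) -> null_seq (fun n => a n ^+ 2).
Proof.
move=> Ha e e0; have [|N HN] := Ha (Num.sqrt e); first by rewrite sqrtr_gt0.
exists N => n Nn; rewrite -real_normK ?num_real // -(sqr_sqrtr (ltW e0)).
by rewrite ltr_pXn2r ?nnegrE ?sqrtr_ge0 ?HN.
Qed.

Lemma null_seq_le (a b : nat -> R) : (forall n, a n <= b n) ->
  null_seq b -> null_seq a.
Proof.
move=> ab Hb e /Hb[N HN]; exists N => n Nn.
by apply: le_lt_trans (HN n Nn).
Qed.

Lemma sqn_cauchy_limit (a : nat -> R[i]) :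
  cauchy_dist (fun m n => sqn (a m - a n)) ->
  exists l, null_seq (fun n => sqn (a n - l)).
Proof.
move=> Ha.
have coord (F : R[i] -> R) : (forall c d, F (c - d) = F c - F d) ->
    (forall c, F c ^+ 2 <= sqn c) ->
    exists l, null_seq (fun n => (F (a n) - l) ^+ 2).
  move=> FB FC; have [|l Hl] := @real_cauchy_limit (fun n => F (a n)); last first.
    by exists l; exact: null_seq_sqr.
  move=> e e0; have [|N HN] := Ha (e ^+ 2); first by rewrite exprn_gt0.
  exists N => m n Nm Nn; rewrite -(@ltr_pXn2r _ 2) ?nnegrE ?(ltW e0) //.
  rewrite real_normK ?num_real // -FB.
  by apply: le_lt_trans (FC _) (HN _ _ Nm Nn).
have [|x Hx] := coord (@complex.Re R) (ltac:(by move=> [? ?] [? ?])).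
  by move=> c; rewrite lerDl sqr_ge0.
have [|y Hy] := coord (@complex.Im R) (ltac:(by move=> [? ?] [? ?])).
  by move=> c; rewrite lerDr sqr_ge0.
exists (Complex x y); apply: null_seq_le (null_seqD Hx Hy) => n.
by case: (a n).
Qed.

Lemma null_seq_sum (a : X -> nat -> R) (s : seq X) :
  (forall x, null_seq (a x)) -> null_seq (fun n => \sum_(x <- s) a x n).
Proof.
move=> Ha; elim: s => [|x s IH].
  by move=> e e0; exists 0%N => n _; rewrite big_nil.
by apply: null_seq_le (null_seqD (Ha x) IH) => n; rewrite big_cons.
Qed.

Lemma l2_complete (u : nat -> l2 R X) :
  cauchy_dist (fun m n => l2_dot (u m - u n) (u m - u n)) ->
  exists l, null_seq (fun n => l2_dot (u n - l) (u n - l)).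
Proof.
move=> Hu.
have /choice[l Hl] x : exists l, null_seq (fun n => sqn (u n x - l)).
  apply: sqn_cauchy_limit => e e0; have [N HN] := Hu e e0.
  exists N => m n Nm Nn; apply: le_lt_trans (HN m n Nm Nn).
  by rewrite l2_dot_self; apply: sqn_le_sqtot (u m - u n) x.
(* The tail of [u] is close to [l] on every finite set of coordinates. *)
have bound e N : (forall m n, (N <= m)%N -> (N <= n)%N ->
      l2_dot (u m - u n) (u m - u n) < e) ->
    forall n, (N <= n)%N -> (etot (fun x => sqn (u n x - l x)%R) <= (2 * e)%:E)%E.
  move=> HN n Nn; apply: etot_le_fin => s us.
  apply: (@null_le _ _ _ _ N (null_seqM (ler0n R 2) (_ : forall m, 0 <= _)
    (null_seq_sum s Hl))) => m; first by apply: sumr_ge0 => x _; exact: sqn_ge0.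
  move=> Nm; apply: (@le_trans _ _ (\sum_(x <- s)
     (2 * sqn ((u n - u m) x) + 2 * sqn (u m x - l x)))).
    apply: ler_sum => x _; apply: le_trans (sqnD_le _ _).
    by rewrite l2D l2N addrA subrK.
  rewrite big_split -!mulr_sumr lerD2r ler_wpM2l //.
  apply: le_trans (sum_le_tot (l2_summable _) us) _.
  by rewrite -/(sqtot _) -l2_dot_self ltW // HN.
have [N0 HN0] := Hu 1 ltr01.
have lP : l2_pred l.
  have d : l2_pred (fun x => u N0 x - l x).
    apply/l2_predP; split=> [x|]; first exact: sqn_ge0.
    exact: le_lt_trans (bound _ _ HN0 N0 (leqnn _)) (ltry _).
  have -> : l = l2_fun (u N0 - L2 d).
    by apply/funext => x; rewrite l2D l2N /= opprB addrC subrK.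
  by case: (u N0 - L2 d).
exists (L2 lP) => e e0; have [N HN] := Hu _ (divr_gt0 e0 (ltr0n _ 4)).
exists N => n Nn; apply: (@le_lt_trans _ _ (2 * (e / 4))); last by lra.
rewrite l2_dot_self -lee_fin -totE; first exact: bound HN n Nn.
exact: l2_summable.
Qed.

End L2Complete.

Canonical l2_hilbert (R : realType) (X : choiceType) : hilbert R :=
  Hilbert (@l2_dotC R X) (@l2_dotDl R X) (@l2_dotZ R X) (@l2_dotZl R X)
    (@l2_dot_gt0 R X) (@l2_complete R X).

Section PointMasses.
Variables (R : realType) (X : choiceType).
Implicit Types (u v w : l2 R X) (c : R[i]) (r : R).

Lemma hnorm_mono u v : (forall x, sqn (u x) <= sqn (v x)) -> hnorm u <= hnorm v.
Proof.
move=> uv; rewrite /hnorm /= !l2_dot_self ler_sqrt; last first.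
  exact: (tot_ge0 (l2_summable v)).
have [|] := @nnsummable_le _ _ (fun x => sqn (u x)) _ _ uv (l2_summable v) => //.
by move=> x; exact: sqn_ge0.
Qed.

Lemma coord_le u x : rnorm (u x) <= hnorm u.
Proof.
rewrite -(@ler_pXn2r _ 2) ?nnegrE ?rnorm_ge0 ?hnorm_ge0 //.
by rewrite hnorm_sqr /= l2_dot_self -sqn_rnorm sqn_le_sqtot.
Qed.

Definition delta_fun (y : X) c : X -> R[i] := fun x => if x == y then c else 0.

Lemma delta_subproof y c : l2_pred (delta_fun y c) /\
  tot (fun x => sqn (delta_fun y c x)) = sqn c.
Proof.
have E : etot (fun x => sqn (delta_fun y c x)) = (sqn c)%:E.
  rewrite /etot (esumID [set y]); last by move=> x _; rewrite lee_fin sqn_ge0.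
  rewrite !setTI esum_set1 /delta_fun ?eqxx; last by rewrite lee_fin sqn_ge0.
  rewrite esum1 ?adde0 // => x /= /eqP/negPf xy.
  by rewrite xy sqn0.
split; last by rewrite /tot E.
by apply/l2_predP; split=> [x|]; [exact: sqn_ge0 | rewrite E ltry].
Qed.

Definition delta y c : l2 R X := L2 (delta_subproof y c).1.

Lemma deltaE y c x : delta y c x = if x == y then c else 0. Proof. by []. Qed.

Lemma hnorm_delta y c : hnorm (delta y c) = rnorm c.
Proof.
rewrite /hnorm /= l2_dot_self /sqtot (delta_subproof y c).2 sqn_rnorm.
by rewrite sqrtr_sqr ger0_norm // rnorm_ge0.
Qed.

Lemma hnorm_sub_delta u y : hnorm (u - delta y (u y)) <= hnorm u.
Proof.
apply: hnorm_mono => x; rewrite l2D l2N deltaE.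
by case: eqVneq => [->|_]; rewrite ?subrr ?sqn0 ?sqn_ge0 // subr0.
Qed.

End PointMasses.

(** * Operators given by partial bijections *)

Record pbij (X : Type) := PBij {
  pb_dom : set X ;
  pb_map : X -> X ;
  pb_cod : set X ;
  pb_inv : X -> X ;
  pb_mapP : forall x, pb_dom x -> pb_cod (pb_map x) /\ pb_inv (pb_map x) = x ;
  pb_invP : forall y, pb_cod y -> pb_dom (pb_inv y) /\ pb_map (pb_inv y) = y
}.

Definition pbij_sym (X : Type) (f : pbij X) : pbij X := PBij (@pb_invP _ f) (@pb_mapP _ f).

Section PartialBijectionOperators.
Variables (R : realType) (X : choiceType).
Implicit Types (f : pbij X) (u v w : l2 R X) (c : R[i]).

(** The partial isometry that moves the point mass at [pb_map f x] to [x]. *)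
Definition pull f (u : X -> R[i]) : X -> R[i] :=
  fun x => if x \in pb_dom f then u (pb_map f x) else 0.

Lemma etot_pullD f (u v : X -> R[i]) :
  etot (fun x => sqn (pull f u x + v x)) =
  (\esum_(y in pb_cod f) (sqn (u y + v (pb_inv f y))%R)%:E +
   \esum_(x in ~` pb_dom f) (sqn (v x))%:E)%E.
Proof.
rewrite /etot (esumID (pb_dom f)); last by move=> x _; rewrite lee_fin sqn_ge0.
rewrite !setTI; congr (_ + _)%E; last first.
  by apply: eq_esum => x /= xD; rewrite /pull memNset // add0r.
rewrite (@reindex_esum _ _ _ (pb_dom f) (pb_cod f) (pb_map f)).
  apply: eq_esum => x xD; rewrite /pull mem_set //.
  by have [_ ->] := pb_mapP xD.
split.
- by move=> x xD; have [] := pb_mapP xD.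
- move=> x y /set_mem xD /set_mem yD xy; have [_ <-] := pb_mapP xD.
  by have [_ <-] := pb_mapP yD; rewrite xy.
- by move=> y yD; have [? ?] := pb_invP yD; exists (pb_inv f y).
Qed.

Lemma etot_pull_symD f (u v : X -> R[i]) :
  etot (fun y => sqn (u y + pull (pbij_sym f) v y)) =
  (\esum_(y in pb_cod f) (sqn (u y + v (pb_inv f y))%R)%:E +
   \esum_(y in ~` pb_cod f) (sqn (u y))%:E)%E.
Proof.
rewrite /etot (esumID (pb_cod f)); last by move=> x _; rewrite lee_fin sqn_ge0.
rewrite !setTI; congr (_ + _)%E; apply: eq_esum => y /= yD.
  by rewrite /pull mem_set.
by rewrite /pull memNset // addr0.
Qed.

Lemma esum_sub_le (A : set X) (a : X -> R) : (forall x, 0 <= a x) ->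
  (\esum_(x in A) (a x)%:E <= etot a)%E.
Proof.
move=> a0; rewrite esum_mkcond; apply: le_esum => x _.
by case: ifP => _ //; rewrite lee_fin.
Qed.

Lemma pull_l2 f u : l2_pred (pull f u) /\
  tot (fun x => sqn (pull f u x)) <= sqtot u.
Proof.
have h : (etot (fun x => sqn (pull f u x)) <= (sqtot u)%:E)%E.
  rewrite -totE; last exact: l2_summable.
  have := etot_pullD f u (fun=> 0); rewrite (esum1 (D := ~` _)); last first.
    by move=> x _; rewrite sqn0.
  rewrite adde0 (_ : (fun x => sqn (pull f u x + 0)) = (fun x => sqn (pull f u x)));
    last by apply/funext => x; rewrite addr0.
  move=> ->; under eq_esum => y _ do rewrite addr0.
  by apply: (@esum_sub_le _ (fun x => sqn (u x))) => x; exact: sqn_ge0.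
have s : nnsummable (fun x => sqn (pull f u x)).
  by split=> [x|]; [exact: sqn_ge0 | exact: le_lt_trans h (ltry _)].
by split; [apply/l2_predP | rewrite -lee_fin -totE].
Qed.

Definition pull_op f : l2 R X -> l2 R X := fun u => L2 (pull_l2 f u).1.

Lemma pull_op_dot f u v :
  l2_dot (pull_op f u) v = l2_dot u (pull_op (pbij_sym f) v).
Proof.
(* Both sides of the polarization formula differ from the same sum over the
   codomain by terms that are insensitive to the sign of [v]. *)
have E w : sqtot (pull_op f u + w) +
    fine (\esum_(y in ~` pb_cod f) (sqn (u y))%:E) =
  sqtot (u + pull_op (pbij_sym f) w) + fine (\esum_(x in ~` pb_dom f) (sqn (w x))%:E).
  apply: EFin_inj; rewrite !EFinD.
  have fin (A : set X) (z : l2 R X) : (\esum_(x in A) (sqn (z x))%:E \is a fin_num)%E.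
    rewrite ge0_fin_numE; last by apply: esum_ge0 => x _; rewrite lee_fin sqn_ge0.
    apply: le_lt_trans (@esum_sub_le A (fun x => sqn (z x)) _) _.
      by move=> x; exact: sqn_ge0.
    by have [] := l2_summable z.
  have totw (z : l2 R X) : (sqtot z)%:E = etot (fun x => sqn (z x)).
    by rewrite totE //; exact: l2_summable.
  rewrite (totw (pull_op f u + w)) (totw (u + _)) !fineK //.
  rewrite (etot_pullD f u w) (etot_pull_symD f u w).
  by rewrite addeAC.
rewrite /l2_dot; have := E v; have := E (- v).
have -> : pull_op (pbij_sym f) (- v) = - pull_op (pbij_sym f) v.
  apply: l2_eq => x; rewrite l2N /= /pull /=.
  by case: ifP; rewrite ?oppr0.
have -> : (fun x => (sqn ((- v) x))%:E) = (fun x => (sqn (v x))%:E).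
  by apply/funext => x; rewrite l2N sqnN.
by move=> E1 E2; congr (_ / _); lra.
Qed.

Lemma pull_op_adjoint f :
  adjoint (pull_op f : l2_hilbert R X -> l2_hilbert R X) (pull_op (pbij_sym f)).
Proof. exact: pull_op_dot. Qed.

Lemma pull_op_linear f c u v : pull_op f (c *: u + v) = c *: pull_op f u + pull_op f v.
Proof.
apply: l2_eq => x; rewrite l2D l2Z /= /pull.
by case: ifP => // _; rewrite mulr0 addr0.
Qed.

Lemma pull_op_bounded f :
  bounded_adjointable (pull_op f : l2_hilbert R X -> l2_hilbert R X).
Proof.
split=> [c u v||].
- exact: pull_op_linear.
- by exists (pull_op (pbij_sym f)); exact: pull_op_adjoint.
- exists 1; split=> // u; rewrite mul1r /hnorm /= !l2_dot_self.
  by rewrite ler_sqrt ?(pull_l2 f u).2 // tot_ge0 //; exact: l2_summable.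
Qed.

Definition pop f : bop (l2_hilbert R X) := mk_bop (pull_op_bounded f).

Lemma popE f (u : l2 R X) x :
  (pop f u : l2 R X) x = if x \in pb_dom f then u (pb_map f x) else 0.
Proof. by []. Qed.

Lemma star_pop f : star (pop f) = pop (pbij_sym f).
Proof. exact/star_bop/pull_op_adjoint. Qed.

Lemma l2_op_eq (S T : bop (l2_hilbert R X)) :
  (forall (u : l2 R X) x, (S u : l2 R X) x = (T u : l2 R X) x) -> S = T.
Proof. by move=> ST; apply: bop_eq => u; apply: l2_eq => x; exact: ST. Qed.

End PartialBijectionOperators.

Section DiagonalProjections.
Variables (R : realType) (X : choiceType).
Implicit Types (D E : set X) (f : pbij X).

Definition pbij_id D : pbij X :=
  @PBij _ D id D id (fun x xD => conj xD erefl) (fun x xD => conj xD erefl).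

Definition dproj D : bop (l2_hilbert R X) := pop R (pbij_id D).

Lemma dprojE D (u : l2 R X) x :
  (dproj D u : l2 R X) x = if x \in D then u x else 0.
Proof. by []. Qed.

Lemma star_dproj D : star (dproj D) = dproj D.
Proof. exact: star_pop. Qed.

Lemma dprojM D E : dproj D ** dproj E = dproj (D `&` E).
Proof.
apply: l2_op_eq => u x; rewrite bopM !dprojE in_setI.
by case: (x \in D); case: (x \in E).
Qed.

Lemma dproj0 : dproj set0 = 0.
Proof. by apply: l2_op_eq => u x; rewrite dprojE in_set0. Qed.

Lemma dprojU D E : dproj (D `|` E) = dproj D + dproj E - dproj (D `&` E).
Proof.
apply: l2_op_eq => u x.
rewrite !bopD bopN !l2D l2N !dprojE in_setU in_setI.
case: (x \in D); case: (x \in E) => /=; rewrite ?(subr0, addr0, add0r) //.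
by rewrite addrK.
Qed.

Lemma pop_mul_sym f : pop R f ** pop R (pbij_sym f) = dproj (pb_dom f).
Proof.
apply: l2_op_eq => u x; rewrite bopM dprojE !popE.
case: ifPn => // /set_mem xD; have [fxD fK] := pb_mapP xD.
by rewrite /= (mem_set fxD) fK.
Qed.

Lemma dproj_pop f : dproj (pb_dom f) ** pop R f = pop R f.
Proof. by apply: l2_op_eq => u x; rewrite bopM dprojE !popE; case: (x \in _). Qed.

End DiagonalProjections.

(** * The boundary path representations *)

Section BoundaryPaths.
Variables (R : realType) (G : ultragraph).

Definition state : choiceType := (vertex G + edge G)%type.

Definition state_vertex (a : state) : vertex G :=
  match a with inl w => w | inr e => src e end.

Definition regular (v : vertex G) : Prop :=
  finite_set [set e : edge G | src e = v] /\ [set e : edge G | src e = v] !=set0.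

Definition path_space : choiceType := (nat -> state).

(** A boundary path is an infinite path, or a finite path ending at a vertex
    that is not regular, where it then stays forever. *)
Definition boundary_path (x : path_space) : Prop :=
  forall n, match x n with
            | inl w => ~ regular w /\ x n.+1 = inl w
            | inr e => rng e (state_vertex (x n.+1))
            end.

Definition path_tail (x : path_space) : path_space := fun n => x n.+1.

Definition path_cons (e : edge G) (x : path_space) : path_space :=
  fun n => if n is m.+1 then x m else inr e.

Definition paths_from (A : set (vertex G)) : set path_space :=
  [set x | boundary_path x /\ A (state_vertex (x 0%N))].

Definition paths_through (e : edge G) : set path_space :=
  [set x | boundary_path x /\ x 0%N = inr e].

Lemma path_tailP e x : paths_through e x ->
  paths_from (rng e) (path_tail x) /\ path_cons e (path_tail x) = x.
Proof.
move=> [bx x0]; split; last by apply/funext => -[].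
by split=> [n|]; [exact: bx n.+1 | have := bx 0%N; rewrite x0].
Qed.

Lemma path_consP e y : paths_from (rng e) y ->
  paths_through e (path_cons e y) /\ path_tail (path_cons e y) = y.
Proof. by move=> [by_ ey]; split=> //; split=> // -[|n] //; exact: by_ n. Qed.

Definition edge_pbij e : pbij path_space := PBij (@path_tailP e) (@path_consP e).

Definition edge_op e : bop (l2_hilbert R path_space) := pop R (edge_pbij e).

Definition vertex_op A : bop (l2_hilbert R path_space) := dproj R (paths_from A).

Lemma paths_fromI A B : paths_from (A `&` B) = paths_from A `&` paths_from B.
Proof.
by apply/seteqP; split=> x; [move=> [? []] | move=> [[? ?] []]]; do !split.
Qed.

Lemma paths_fromU A B : paths_from (A `|` B) = paths_from A `|` paths_from B.
Proof.
apply/seteqP; split=> x; first by move=> [bx [xA|xB]]; [left|right].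
by case=> -[bx ?]; split=> //; [left|right].
Qed.

Lemma paths_through_from e : paths_through e `<=` paths_from [set src e].
Proof. by move=> x [bx x0]; split=> //; rewrite x0. Qed.

(** At a regular vertex a boundary path cannot stop. *)
Lemma paths_from_regular v x : regular v -> paths_from [set v] x ->
  exists2 e, src e = v & paths_through e x.
Proof.
move=> rv [bx xv]; have := bx 0%N; move: xv; case E: (x 0%N) => [w|e] /=.
  by move=> -> [].
by move=> ev _; exists e.
Qed.

Lemma mulJ_rnorm1 (z : R[i]) : rnorm z = 1 -> z * Num.conj z = 1.
Proof. by move=> z1; rewrite mul_conj_rnorm z1 expr1n rmorph1. Qed.

(** For varying phase [z] this is the gauge action, seen in one representation. *)
Lemma gauge_family (z : R[i]) : rnorm z = 1 ->
  CK_family (fun e => z *: edge_op e) vertex_op.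
Proof.
move=> z1; have zz := mulJ_rnorm1 z1.
have starE e : star (z *: edge_op e) = Num.conj z *: pop R (pbij_sym (edge_pbij e)).
  by rewrite starZ star_pop.
have TT e : (z *: edge_op e) ** star (z *: edge_op e) = dproj R (paths_through e).
  by rewrite starE cmulZl cmulZr scalerA zz scale1r pop_mul_sym.
split.
- by move=> e; rewrite /partial_isometry TT cmulZr (dproj_pop R (edge_pbij e)).
- move=> e f ef; rewrite !TT dprojM -(dproj0 R); congr dproj.
  by apply/seteqP; split=> x // [[_ xe] [_ xf]]; apply: ef; move: xe; rewrite xf => -[].
- by move=> A _; split; rewrite ?star_dproj // dprojM setIid.
- rewrite /vertex_op -(dproj0 R path_space); congr dproj.
  by apply/seteqP; split=> x // [].
- by move=> A B _ _; rewrite dprojM -paths_fromI.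
- by move=> A B _ _; rewrite /vertex_op paths_fromU dprojU paths_fromI.
- move=> e; rewrite starE cmulZl cmulZr scalerA mulrC zz scale1r.
  exact: (pop_mul_sym R (pbij_sym (edge_pbij e))).
- move=> e; rewrite /proj_le TT dprojM; congr dproj.
  by apply/setIidl; exact: paths_through_from.
(* Exactly one term of the sum is nonzero at a path from [v]: the one of its
   first edge. *)
- move=> v finv v0; under eq_fsbigr do rewrite TT.
  rewrite fsbig_finite //; set s := fset_set _.
  apply: l2_op_eq => u x; rewrite dprojE.
  rewrite (@big_morph _ _ (fun T : bop (l2_hilbert R path_space) =>
      (T u : l2 R path_space) x) 0 +%R) //.
  case: ifPn => [/set_mem xv|xv]; last first.
    rewrite big1_seq // => e /andP[_]; rewrite in_fset_set // => /set_mem ev.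
    rewrite dprojE memNset // => xe; move/negP: xv; apply; apply: mem_set.
    by rewrite -ev; exact: paths_through_from.
  have [e ev xe] := paths_from_regular (conj finv v0) xv.
  rewrite (bigD1_seq e) //=; last 2 first.
  - by rewrite in_fset_set //; apply: mem_set.
  - exact: finmap.fset_uniq.
  rewrite /pull /= mem_set // big1 ?addr0 // => f fe; rewrite memNset //.
  move=> [_ xf]; move: fe; case: xe => _; rewrite xf => -[->].
  by rewrite eqxx.
Qed.

End BoundaryPaths.

(** * Representations on a Hilbert space are contractive *)

Section CStarNorm.
Variables (R : realType) (A : cstarAlgType R).
Implicit Types (x y z a b : A) (c : R[i]).

Lemma cmul0l x : 0 ** x = 0.
Proof. by rewrite -(scale0r (0 : A)) cmulZl !scale0r. Qed.

Lemma cmul0r x : x ** 0 = 0.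
Proof. by rewrite -(scale0r (0 : A)) cmulZr !scale0r. Qed.

Lemma cmulNl x y : (- x) ** y = - (x ** y).
Proof. by rewrite -scaleN1r cmulZl scaleN1r. Qed.

Lemma cmulNr x y : x ** (- y) = - (x ** y).
Proof. by rewrite -scaleN1r cmulZr scaleN1r. Qed.

Lemma star0 : star (0 : A) = 0.
Proof. by rewrite -(scale0r (0 : A)) starZ conjC0 !scale0r. Qed.

Lemma starN x : star (- x) = - star x.
Proof. by rewrite -scaleN1r starZ rmorphN rmorph1 scaleN1r. Qed.

Lemma rnorm_cmul x y : rnorm (x ** y) <= rnorm x * rnorm y.
Proof. by rewrite -lecR rmorphM /= -!rnormE norm_cmul_le. Qed.

Lemma rnorm_cstar x : rnorm (star x ** x) = rnorm x ^+ 2.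
Proof.
by apply: (@complexI R); rewrite rmorphXn /= -!rnormE cstar_identity.
Qed.

Lemma rnorm_star x : rnorm (star x) = rnorm x.
Proof.
have le y : rnorm y <= rnorm (star y).
  have [y0|y0] := eqVneq (rnorm y) 0; first by rewrite y0 rnorm_ge0.
  have {}y0 : 0 < rnorm y by rewrite lt_def y0 rnorm_ge0.
  by rewrite -(ler_pM2r y0) -expr2 -rnorm_cstar rnorm_cmul.
by apply/eqP; rewrite eq_le le andbT -{2}(starK x) le.
Qed.

(** The solution is [1 - sqrt (1 - x)], written without the unit; it is found
    as a fixed point of the contraction [y |-> (x + y ^ 2) / 2]. *)
Lemma sqrt_complement x : star x = x -> rnorm x < 1 ->
  exists2 y, star y = y & x = y + y - y ** y.
Proof.
move=> xx x1; set r := rnorm x in x1; have r0 : 0 <= r by exact: rnorm_ge0.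
(* This radius satisfies [r + q ^ 2 <= 2 * q], so the iterates stay in the ball
   of radius [q], where the contraction factor is [q < 1]. *)
pose q : R := (1 + r) / 2.
have q1 : q < 1 by rewrite /q; lra.
have q0 : 0 <= q by rewrite /q; lra.
pose F y : A := (2^-1 : R)%:C *: (x + y ** y).
pose u n := iter n F 0.
have nhalf : rnorm ((2^-1 : R)%:C : R[i]) = 2^-1 by rewrite rnormC ger0_norm.
have uq n : rnorm (u n) <= q.
  elim: n => [|n IH]; first by rewrite rnorm0.
  rewrite /u iterS -/(u n) rnormZ nhalf.
  have := rnormD x (u n ** u n); have := rnorm_cmul (u n) (u n).
  have := rnorm_ge0 (u n); rewrite -/r => h1 h2 h3.
  have h4 : rnorm (u n) * rnorm (u n) <= q * q by rewrite ler_pM.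
  have : r + q * q <= 2 * q.
    rewrite /q -subr_ge0.
    have -> : 2 * ((1 + r) / 2) - (r + (1 + r) / 2 * ((1 + r) / 2)) =
      (1 - r) * (3 + r) / 4 by field.
    by rewrite divr_ge0 // mulr_ge0 //; lra.
  lra.
have us n : star (u n) = u n.
  elim: n => [|n IH]; first exact: star0.
  rewrite /u iterS -/(u n) starZ starD xx starM IH.
  by congr (_ *: _); rewrite conj_Creal // complex_real.
have FB a b : rnorm (F a - F b) <= (rnorm a + rnorm b) / 2 * rnorm (a - b).
  rewrite -scalerBr rnormZ nhalf.
  have -> : x + a ** a - (x + b ** b) = a ** (a - b) + (a - b) ** b.
    rewrite cmulDr cmulDl cmulNr cmulNl addrA subrK opprD addrACA subrr add0r.
    by [].
  have := rnormD (a ** (a - b)) ((a - b) ** b).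
  have := rnorm_cmul a (a - b); have := rnorm_cmul (a - b) b; nra.
have [|l Hl] := @cauchy_limit _ _ u.
  apply: (@geometric_cauchy _ _ _ 1 q) => //.
  elim=> [|n IH].
    rewrite expr0 mul1r subr0; exact: le_trans (uq 1%N) (ltW q1).
  rewrite /u !iterS -!/(iter _ _ _) -!iterS -/(u n) -/(u n.+1).
  apply: le_trans (FB _ _) _; rewrite mul1r exprS ler_pM ?rnorm_ge0 //.
  - by rewrite divr_ge0 // addr_ge0 // rnorm_ge0.
  - by have := uq n; have := uq n.+1; lra.
  - by rewrite -[X in _ <= X]mul1r.
exists l.
  apply: subr0_eq; apply: rnorm_eq0; apply/eqP.
  rewrite eq_le rnorm_ge0 andbT.
  apply: (@null_le _ _ _ _ 0%N (null_seqD Hl Hl)) => n _; rewrite add0r.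
  apply: le_trans (rnorm_dist _ (u n) _) _; rewrite lerD2r.
  by rewrite -{1}(us n) rnormB -starN -starD rnorm_star.
have lq : rnorm l <= q.
  apply: (@null_le _ _ _ _ 0%N Hl) => n _; rewrite -{1}(subrK (u n) l) addrC.
  by apply: le_trans (rnormD _ _) _; rewrite lerD // rnormB.
have Fl : F l = l.
  apply: subr0_eq; apply: rnorm_eq0; apply/eqP.
  rewrite eq_le rnorm_ge0 andbT.
  have Hl1 : null_seq (fun n => rnorm (u n.+1 - l)).
    by move=> e /Hl[N HN]; exists N => n Nn; apply: HN; apply: leqW.
  apply: (@null_le _ _ _ _ 0%N (null_seqD Hl Hl1)) => n _; rewrite add0r.
  apply: le_trans (rnorm_dist _ (u n.+1) _) _; rewrite lerD2r.
  rewrite rnormB; apply: le_trans (FB _ _) _.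
  have := uq n; have := rnorm_ge0 (u n - l); nra.
have E : l + l = x + l ** l.
  rewrite -{1 2}Fl /F -scalerDl -rmorphD /= -[in LHS](mul1r 2^-1) -splitr.
  by rewrite rmorph1 scale1r.
by rewrite E addrK.
Qed.

End CStarNorm.

Section Contractive.
Variables (R : realType) (A : cstarAlgType R) (H : hilbert R).
Variables (f : {linear A -> bop H}) (fstar : star_morphism f).

Lemma morphM a b : f (a ** b) = f a ** f b. Proof. by case: fstar => ->. Qed.
Lemma morph_star a : f (star a) = star (f a). Proof. by case: fstar => _ ->. Qed.

(** If [b] has norm less than [1], then [star b ** b = 1 - (1 - y) ^ 2] with [y]
    self-adjoint, so the squared norm of [f b x] is that of [x] minus that of
    [x - f y x]. *)
Lemma rnorm_morph a : rnorm (f a) <= rnorm a.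
Proof.
have lt1 b : rnorm b < 1 -> rnorm (f b) <= 1.
  move=> b1.
  have [||y yy E] := @sqrt_complement _ _ (star b ** b).
  - by rewrite starM starK.
  - by rewrite rnorm_cstar expr_lt1 // rnorm_ge0.
  rewrite rnorm_bop; apply: opnorm_le; split=> // x.
  rewrite mul1r; apply: hnorm_le; first exact: hnorm_ge0.
  rewrite hnorm_sqr bop_adj -morph_star -bopM -morphM E.
  rewrite linearB linearD (morphM y y) !bopD bopN bopM !dotDr dotNr.
  have Y z t : dot z (f y t) = dot (f y z) t by rewrite bop_adj -morph_star yy.
  rewrite (Y x (f y x)).
  have := dot_ge0 (x - f y x).
  by rewrite dotDl !dotDr !dotNl !dotNr (dotC (f y x) x); lra.
apply/ler_addgt0Pr => e e0.
have d0 : 0 < rnorm a + e by rewrite ltr_wpDl ?rnorm_ge0.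
have /lt1 : rnorm ((rnorm a + e)^-1%:C *: a) < 1.
  rewrite rnormZ rnormC ger0_norm ?invr_ge0 ?(ltW d0) // mulrC ltr_pdivrMr //.
  by rewrite mul1r ltrDl.
rewrite linearZ rnormZ rnormC ger0_norm ?invr_ge0 ?(ltW d0) // mulrC.
by rewrite ler_pdivrMr // mul1r.
Qed.

Lemma hnorm_morph_le a x : hnorm (f a x) <= rnorm a * hnorm x.
Proof.
apply: le_trans (opnormP _ _) _.
by rewrite ler_wpM2r ?hnorm_ge0 // -rnorm_bop rnorm_morph.
Qed.

End Contractive.

(** * Algebraic operators *)

Section PolynomialAction.
Variables (K : fieldType) (V : lmodType K) (T : V -> V).
Hypothesis Tlin : forall (c : K) (x y : V), T (c *: x + y) = c *: T x + T y.
Implicit Types (p q : {poly K}) (x y : V) (c a : K).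

Definition pact p x : V := \sum_(i < size p) p`_i *: iter i T x.

Lemma pact_widen n p x : (size p <= n)%N ->
  pact p x = \sum_(i < n) p`_i *: iter i T x.
Proof.
move=> pn; rewrite /pact (big_ord_widen n (fun i => p`_i *: iter i T x)) //.
rewrite big_mkcond; apply: eq_bigr => i _.
by case: ltnP => // pi; rewrite nth_default // scale0r.
Qed.

Lemma lin0 : T 0 = 0.
Proof. by apply: (addrI (1 *: T 0)); rewrite -Tlin scale1r !addr0 scale1r. Qed.

Lemma linD x y : T (x + y) = T x + T y.
Proof. by have := Tlin 1 x y; rewrite !scale1r. Qed.

Lemma linZ c x : T (c *: x) = c *: T x.
Proof. by rewrite -[c *: x]addr0 Tlin lin0 addr0. Qed.

Lemma pactD p q x : pact (p + q) x = pact p x + pact q x.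
Proof.
pose n := maxn (size p) (size q).
rewrite (@pact_widen n (p + q)) ?size_polyD //.
rewrite (@pact_widen n p) ?leq_maxl // (@pact_widen n q) ?leq_maxr //.
by rewrite -big_split; apply: eq_bigr => i _; rewrite coefD scalerDl.
Qed.

Lemma pactC c x : pact c%:P x = c *: x.
Proof. by rewrite (@pact_widen 1) ?size_polyC_leq1 // big_ord1 coefC. Qed.

Lemma pactMX p x : pact (p * 'X) x = T (pact p x).
Proof.
rewrite (@pact_widen (size p).+1); last first.
  by rewrite (leq_trans (size_polyMleq _ _)) // size_polyX addnS addn1.
rewrite big_ord_recl coefMX eqxx scale0r add0r /pact.
rewrite (big_morph T linD lin0); apply: eq_bigr => i _.
by rewrite coefMX lift0 /= linZ.
Qed.

Lemma pactM p q x : pact (p * q) x = pact p (pact q x).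
Proof.
elim/poly_ind: p => [|p c IH]; first by rewrite mul0r /pact size_poly0 !big_ord0.
rewrite mulrDl !pactD mulrAC !pactMX IH pactC; congr (_ + _).
rewrite mul_polyC (@pact_widen (size q) (c *: q)) ?size_scale_leq // /pact.
by rewrite scaler_sumr; apply: eq_bigr => i _; rewrite coefZ scalerA.
Qed.

Lemma pact_factor q a x : pact (('X - a%:P) * q) x = T (pact q x) - a *: pact q x.
Proof.
rewrite mulrBl pactD mulrC pactMX; congr (_ + _).
by rewrite -mulNr -polyCN pactM pactC scaleNr.
Qed.

Lemma pact_eigen p a x : T x = a *: x -> pact p x = p.[a] *: x.
Proof.
move=> Tx; elim/poly_ind: p => [|p c IH].
  by rewrite /pact size_poly0 big_ord0 horner0 scale0r.
by rewrite pactD pactMX pactC IH linZ Tx !hornerE scalerA -scalerDl.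
Qed.

Definition annihilates p : Prop := forall x, pact p x = 0.

Lemma min_annihilator p : p != 0 -> annihilates p ->
  exists2 m, m != 0 /\ annihilates m &
    forall q, q != 0 -> annihilates q -> (size m <= size q)%N.
Proof.
move=> p0 pT.
pose P n := `[< exists2 q, q != 0 /\ annihilates q & size q = n >].
have exP : exists n, P n by exists (size p); apply/asboolP; exists p.
have [n /asboolP[m mT <-] nmin] := ex_minnP exP.
exists m => // q q0 qT; apply: nmin; apply/asboolP; by exists q.
Qed.

(** Dividing [m] by ['X - a%:P] leaves a polynomial that is too small to annihilate,
    and its nonzero values are eigenvectors. *)
Lemma min_annihilator_root m a : m != 0 -> annihilates m ->
  (forall q, q != 0 -> annihilates q -> (size m <= size q)%N) ->
  root m a -> exists2 x, x != 0 & T x = a *: x.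
Proof.
move=> m0 mT mmin /factor_theorem[q mE].
have q0 : q != 0 by apply: contraNneq m0 => q0; rewrite mE q0 mul0r.
have [y qy] : exists y, pact q y != 0.
  apply: contrapT => /forallNP qT.
  have qA : annihilates q by move=> y; apply/eqP/negPn/negP; exact: qT.
  by have := mmin q q0 qA; rewrite mE size_Mmonic ?monicXsubC // size_XsubC addn2 ltnn.
exists (pact q y) => //; apply: subr0_eq.
by rewrite -pact_factor mulrC -mE mT.
Qed.

(** As [a] is not a root of a minimal annihilator, division by ['X - a%:P] leaves a
    nonzero constant, and the quotient inverts [T - a] up to that constant. *)
Lemma algebraic_inj_surj p a : p != 0 -> annihilates p ->
  (forall x, T x = a *: x -> x = 0) -> forall y, exists x, T x - a *: x = y.
Proof.
move=> p0 pT inj y; have [m [m0 mT] mmin] := min_annihilator p0 pT.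
have ma : ~~ root m a.
  apply/negP => /(min_annihilator_root m0 mT mmin)[x x0 /inj xE].
  by rewrite xE eqxx in x0.
have /factor_theorem[q qE] : root (m - (m.[a])%:P) a.
  by rewrite /root !hornerE subrr.
have mE : m = ('X - a%:P) * q + (m.[a])%:P by rewrite mulrC -qE subrK.
have := mT y; rewrite mE pactD pact_factor pactC => /eqP.
rewrite addr_eq0 => /eqP E; exists (pact q (- (m.[a])^-1 *: y)).
rewrite -pact_factor -pactC -pactM mulrC pactM pact_factor E pactC.
by rewrite scalerN scaleNr opprK scalerA mulVf ?scale1r.
Qed.

End PolynomialAction.

Section FiniteDimensional.
Variables (R : realType).

Lemma linear_dependence (K : fieldType) (V : lmodType K) n (b : 'I_n -> V)
    (w : nat -> V) :
  (forall i, exists c : 'I_n -> K, w i = \sum_(j < n) c j *: b j) ->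
  exists2 v : 'I_n.+1 -> K, (exists i, v i != 0) & \sum_(i < n.+1) v i *: w i = 0.
Proof.
move=> /choice[c cE].
pose C := \matrix_(i < n.+1, j < n) c i j.
have : kermx C != 0.
  by rewrite kermx_eq0 /row_free ltn_eqF // ltnS rank_leq_col.
move=> /rowV0Pn[v /sub_kermxP vC v0].
exists (fun i => v 0 i).
  by have /rV0Pn[i vi] := v0; exists i.
under eq_bigr => i _ do rewrite cE scaler_sumr.
rewrite exchange_big big1 //= => j _.
under eq_bigr do rewrite scalerA.
rewrite -scaler_suml; have := congr1 (fun M : 'rV_n => M 0 j) vC.
rewrite !mxE => E; rewrite -[X in X *: _ = _](_ : \sum_(i < n.+1) v 0 i * C i j = _).
  by rewrite E scale0r.
by apply: eq_bigr => i _; rewrite mxE.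
Qed.

(** The powers of [t] are linearly dependent. The polynomial is found in [A], so it
    does not depend on the representation; this matters when the representation
    varies continuously. *)
Lemma finite_dim_algebraic (A : cstarAlgType R) (F : set A) (t : A) :
  star_subalgebra F -> finite_dimensional F -> F t ->
  exists2 m : {poly R[i]}, m != 0 &
    forall (H : hilbert R) (f : {linear A -> bop H}), star_morphism f ->
      annihilates (f t) m.
Proof.
move=> [_ _ FM _] [n [b FE]] Ft.
pose w i := iter i (cmul t) t.
have Fw i : F (w i) by elim: i => [|i IH] //; apply: FM.
have [|v [i0 vi0] vw] := @linear_dependence _ _ n b w.
  by move=> i; have := Fw i; rewrite FE.
(* The constant term vanishes because [F] need not contain a unit. *)
pose m : {poly R[i]} := \poly_(i < n.+1) (v (inord i)) * 'X.
have mi (i : 'I_n.+1) : (\poly_(i < n.+1) (v (inord i)))`_i = v i.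
  by rewrite coef_poly ltn_ord inord_val.
exists m.
  rewrite mulf_neq0 ?polyX_eq0 //; apply: contraNneq vi0 => E.
  by rewrite -mi E coef0.
move=> H f fstar x; rewrite /m pactM; last exact: bop_linear.
have -> : pact (f t) 'X x = f t x.
  rewrite -[X in pact _ X _](mul1r 'X) pactMX; last exact: bop_linear.
  by rewrite -[1]/(1%:P) pactC scale1r.
rewrite (@pact_widen _ _ _ n.+1) ?size_poly //.
transitivity (f (\sum_(i < n.+1) v i *: w i) x); last by rewrite vw linear0.
have fw i : f (w i) x = iter i (f t) (f t x).
  by elim: i => [|i IH] //=; rewrite (morphM fstar) bopM -IH.
rewrite linear_sum (big_morph (fun S : bop H => S x) (id1 := 0) (op1 := +%R)) //.
by apply: eq_bigr => i _; rewrite mi linearZ bopZ fw.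
Qed.

End FiniteDimensional.

(** * Isometries in AF algebras are unitary *)

Section AFIsometry.
Variables (R : realType) (A : cstarAlgType R).

Lemma AF_approx (a b : A) (e : R) : AF A -> 0 < e ->
  exists F : set A, [/\ star_subalgebra F, finite_dimensional F &
    exists c d, [/\ F c, F d, rnorm (a - c) < e & rnorm (b - d) < e]].
Proof.
move=> [F [Ffin Fmono Fdense]] e0.
have leF m n : (m <= n)%N -> F m `<=` F n.
  elim: n => [|n IH]; first by rewrite leqn0 => /eqP ->.
  rewrite leq_eqVlt => /orP[/eqP -> //|]; rewrite ltnS => /IH h.
  exact: subset_trans h (Fmono n).
have approx x : exists n c, F n c /\ rnorm (x - c) < e.
  have : closure (\bigcup_n F n) x by rewrite Fdense.
  by move=> /closure_rnorm/(_ e0)[c [n _ Fc] xc]; exists n, c.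
have [n [c [Fc ac]]] := approx a; have [m [d [Fd bd]]] := approx b.
have [Fs Fd'] := Ffin (maxn n m).
exists (F (maxn n m)); split=> //; exists c, d; split=> //.
  exact: (leF n) (leq_maxl _ _) _ Fc.
exact: (leF m) (leq_maxr _ _) _ Fd.
Qed.

(** [s + 1 - p] is an isometry near [1 + g] with [g] algebraic, and for the
    latter injectivity implies surjectivity. *)
Lemma AF_isometry_dense_range (H : hilbert R) (f : {linear A -> bop H}) (s p : A) :
  AF A -> star_morphism f -> projection p -> star s ** s = p -> p ** s = s ->
  forall y : H, (forall x, dot (f s x + (x - f p x)) y = 0) -> y = 0.
Proof.
move=> AFA fstar [pp pstar] ssp ps y Uy.
have [||F [FS Ffin [t [q [Ft Fq st pq]]]]] := @AF_approx s p (1 / 8) => //.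
have Fg : F (t - q).
  have [F0 FL _ _] := FS; rewrite addrC -scaleN1r; exact: FL.
have [m m0 mT] := finite_dim_algebraic FS Ffin Fg.
pose g := f (t - q).
have Uiso x : hnorm (f s x + (x - f p x)) = hnorm x.
  congr Num.sqrt.
  have P z w : dot (f p z) w = dot z (f p w).
    by rewrite bop_adj -(morph_star fstar) pstar.
  have PP z : f p (f p z) = f p z by rewrite -bopM -(morphM fstar) pp.
  have PS z : f p (f s z) = f s z by rewrite -bopM -(morphM fstar) ps.
  have SS : dot (f s x) (f s x) = dot x (f p x).
    by rewrite bop_adj -(morph_star fstar) -bopM -(morphM fstar) ssp.
  have SP : dot (f s x) (f p x) = dot (f s x) x by rewrite -P PS.
  have PxPx : dot (f p x) (f p x) = dot x (f p x) by rewrite P PP.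
  rewrite !dotDl !dotDr !dotNl !dotNr SS PxPx (dotC x (f s x)).
  by rewrite (dotC (f p x) (f s x)) SP (dotC (f p x) x); ring.
have near x : hnorm (g x + x - (f s x + (x - f p x))) <= 1 / 4 * hnorm x.
  have -> : g x + x - (f s x + (x - f p x)) = f (t - s) x - f (q - p) x.
    have regroup (V : zmodType) (a b c d z : V) :
        a - b + z - (c + (z - d)) = a - c - (b - d).
      rewrite (addrC c) opprD opprB addrA addrACA subrr addr0.
      by rewrite addrAC (addrAC a) opprB (addrC d) addrA.
    have fB (a b : A) z : f (a - b) z = f a z - f b z by rewrite linearB.
    by rewrite /g !fB regroup.
  have h1 : hnorm (f (t - s) x) <= 1 / 8 * hnorm x.
    apply: le_trans (hnorm_morph_le fstar _ _) _.
    by rewrite ler_wpM2r ?hnorm_ge0 // rnormB ltW.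
  have h2 : hnorm (f (q - p) x) <= 1 / 8 * hnorm x.
    apply: le_trans (hnorm_morph_le fstar _ _) _.
    by rewrite ler_wpM2r ?hnorm_ge0 // rnormB ltW.
  have := hnormD (f (t - s) x) (- f (q - p) x); rewrite hnormN; lra.
have low x : 3 / 4 * hnorm x <= hnorm (g x + x).
  have := hnorm_dist 0 (g x + x) (f s x + (x - f p x)).
  rewrite !sub0r !hnormN Uiso; have := near x; lra.
have [|x] := @algebraic_inj_surj _ _ g (bop_linear g) m (-1) m0 (mT _ _ fstar) _ y.
  move=> x; rewrite scaleN1r => gx; have := low x; rewrite gx addNr hnorm0 => h.
  by apply: hnorm_eq0; apply/eqP; rewrite eq_le hnorm_ge0 andbT; lra.
rewrite scaleN1r opprK => gx.
apply: hnorm_eq0; apply/eqP; rewrite eq_le hnorm_ge0 andbT.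
have h1 : dot y y = dot (g x + x - (f s x + (x - f p x))) y.
  by rewrite gx dotDl dotNl Uy subr0.
have h2 := dot_le_hnorm (g x + x - (f s x + (x - f p x))) y.
have h3 := near x; have h4 := low x; rewrite gx in h4.
have h5 := hnorm_sqr y; have h6 := hnorm_ge0 y.
rewrite leNgt; apply/negP => y0.
have : hnorm y * hnorm y <= 1 / 3 * hnorm y * hnorm y.
  rewrite -{1}expr2 h5 h1; apply: le_trans h2 _; rewrite ler_wpM2r //; lra.
by rewrite -mulrA -subr_ge0 => h7; have := mulr_gt0 y0 y0; lra.
Qed.

End AFIsometry.

(** * Perturbations of rank one operators *)

Section RankOne.
Variables (R : realType) (X : choiceType) (x0 : X).
Implicit Types (T : bop (l2_hilbert R X)) (u v : l2 R X) (w a : R[i]).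

(** The bound [1 / 16] makes every eigenvalue of [T] either at most [1 / 4] in
    modulus or within [1 / 8] of [w]. *)
Definition near_rank_one T w : Prop :=
  rnorm w = 1 /\
  forall u, hnorm ((T u : l2 R X) - delta x0 (w * u x0)) <= 1 / 16 * hnorm u.

Definition normal_eigenvector T a u : Prop :=
  [/\ u x0 = 1, T u = a *: u & hnorm (u - delta x0 1) <= 1].

Lemma delta_norm_split u : hnorm u <= rnorm (u x0) + hnorm (u - delta x0 (u x0)).
Proof.
have := @hnormD _ _ (delta x0 (u x0)) (u - delta x0 (u x0)).
by rewrite hnorm_delta addrC subrK.
Qed.

(** With this lemma and [near_rank_one_rest], [T] is controlled separately along
    [delta x0 1] and along its orthogonal complement. *)
Lemma near_rank_one_coord T w u : near_rank_one T w ->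
  rnorm ((T u : l2 R X) x0 - w * u x0) <= 1 / 16 * hnorm u.
Proof.
move=> [_ Tw]; apply: le_trans (Tw u);
have := coord_le (((T u : l2 R X) - delta x0 (w * u x0)) : l2 R X) x0.
by rewrite l2D l2N deltaE eqxx.
Qed.

Lemma near_rank_one_rest T w u : near_rank_one T w ->
  hnorm ((T u : l2 R X) - delta x0 ((T u : l2 R X) x0)) <= 1 / 16 * hnorm u.
Proof.
move=> [_ Tw]; apply: le_trans (Tw u).
set e : l2 R X := (T u : l2 R X) - delta x0 (w * u x0).
have -> : (T u : l2 R X) - delta x0 ((T u : l2 R X) x0) = e - delta x0 (e x0).
  apply: l2_eq => x; rewrite !(l2D, l2N) !deltaE eqxx.
  by case: eqVneq => [->|_]; rewrite ?subr0 // !subrr.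
exact: hnorm_sub_delta.
Qed.

(** The cone around [delta x0 1] is mapped into itself by [T - a] when [a] is
    small, so a minimal polynomial of [T] must have a large root. *)
Lemma near_rank_one_eigen T w m : near_rank_one T w -> m != 0 -> annihilates T m ->
  exists a u, root m a /\ normal_eigenvector T a u.
Proof.
move=> Tw m0 mT.
have Tlin := bop_linear T.
have [w1 _] := Tw.
have [p [p0 pT] pmin] := min_annihilator m0 mT.
pose cone (u : l2 R X) := 0 < rnorm (u x0) /\
  hnorm (u - delta x0 (u x0)) <= rnorm (u x0).
have cone_step a u : rnorm a <= 1 / 4 -> cone u -> cone ((T u : l2 R X) - a *: u).
  move=> a4 [u0 uc]; set v : l2 R X := (T u : l2 R X) - a *: u.
  have us := delta_norm_split u.
  have h1 := near_rank_one_coord u Tw; have h2 := near_rank_one_rest u Tw.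
  set d : R[i] := (T u : l2 R X) x0 - w * u x0 in h1.
  have vx : v x0 = w * u x0 - a * u x0 + d.
    by rewrite /v l2D l2N l2Z /d; ring.
  have h3 : 5 / 8 * rnorm (u x0) <= rnorm (v x0).
    have := rnormD (v x0) (a * u x0 - d).
    rewrite (_ : v x0 + _ = w * u x0); last by rewrite vx; ring.
    have := rnormD (a * u x0) (- d); rewrite rnormN !rnormM w1 mul1r.
    have : rnorm a * rnorm (u x0) <= 1 / 4 * rnorm (u x0).
      by rewrite ler_wpM2r // ltW.
    lra.
  split; first lra.
  have -> : v - delta x0 (v x0) =
     ((T u : l2 R X) - delta x0 ((T u : l2 R X) x0)) - a *: (u - delta x0 (u x0)).
    apply: l2_eq => x; rewrite !(l2D, l2N, l2Z) !deltaE /v ?l2D ?l2N ?l2Z.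
    by case: eqVneq => [->|_]; ring.
  apply: le_trans (hnormD _ _) _; rewrite hnormN hnormZ.
  have : rnorm a * hnorm (u - delta x0 (u x0)) <= 1 / 4 * rnorm (u x0).
    by rewrite ler_pM ?rnorm_ge0 ?hnorm_ge0.
  lra.
(* Were all roots small, the polynomial would map [delta x0 1] into the cone, hence
   not to zero. *)
have [a [ra pa]] : exists a, 1 / 4 < rnorm a /\ root p a.
  apply: contrapT => /forallNP small.
  have [r pE] := closed_field_poly_normal p.
  have rsmall a : a \in r -> rnorm a <= 1 / 4.
    move=> ar; rewrite leNgt; apply/negP => ra; apply: (small a); split=> //.
    by rewrite pE rootZ ?lead_coef_eq0 // root_prod_XsubC.
  have : cone (pact T (\prod_(z <- r) ('X - z%:P)) (delta x0 1)).
    elim: r rsmall {pE} => [|a r IH] rsmall.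
      rewrite big_nil -[1]/(1%:P) pactC scale1r; split.
        by rewrite deltaE eqxx rnorm1.
      by rewrite deltaE eqxx subrr hnorm0 rnorm_ge0.
    rewrite big_cons pact_factor //; apply: cone_step.
      by apply: rsmall; rewrite inE eqxx.
    by apply: IH => b br; apply: rsmall; rewrite inE br orbT.
  have : pact T p (delta x0 1) = 0 by exact: pT.
  rewrite pE -mul_polyC pactM // pactC => /eqP.
  rewrite scaler_eq0 lead_coef_eq0 (negPf p0) /= => /eqP -> [].
  by rewrite l20 rnorm0 ltxx.
have [u u0 Tu] := min_annihilator_root Tlin p0 pT pmin pa.
have ma : root m a.
  rewrite /root; apply/eqP; have := mT u; rewrite (pact_eigen Tlin m Tu) => /eqP.
  by rewrite scaler_eq0 (negPf u0) orbF => /eqP.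
have us := delta_norm_split u.
have := near_rank_one_rest u Tw; rewrite Tu.
have -> : (a *: u : l2 R X) - delta x0 ((a *: u : l2 R X) x0)
   = a *: (u - delta x0 (u x0)).
  apply: l2_eq => x; rewrite !(l2D, l2N, l2Z) !deltaE.
  by case: eqVneq => [->|_]; ring.
rewrite hnormZ => h1.
have h2 := hnorm_ge0 (u - delta x0 (u x0)).
have h3 : 1 / 4 * hnorm (u - delta x0 (u x0)) <= rnorm a * hnorm (u - delta x0 (u x0)).
  by rewrite ler_wpM2r // ltW.
have h4 : hnorm (u - delta x0 (u x0)) <= 1 / 3 * rnorm (u x0) by lra.
have ux0 : u x0 != 0.
  apply: contraNneq u0 => ux; apply/eqP/hnorm_eq0/eqP.
  rewrite eq_le hnorm_ge0 andbT; rewrite ux rnorm0 in h4 us *.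
  by apply: le_trans us _; lra.
exists a, ((u x0)^-1 *: u); split=> //; split.
- by rewrite l2Z mulVf.
- by rewrite bop_atZ Tu !scalerA mulrC.
- have -> : (u x0)^-1 *: u - delta x0 1 = (u x0)^-1 *: (u - delta x0 (u x0)).
    apply: l2_eq => x; rewrite !(l2D, l2N, l2Z) !deltaE.
    by case: eqVneq => [->|_]; rewrite ?subr0 // subrr mulr0 mulVf ?subrr.
  have ru : 0 < rnorm (u x0).
    by rewrite lt_def rnorm_ge0 andbT; apply: contraNneq ux0 => /rnorm_eq0 ->.
  rewrite hnormZ -(ler_pM2l ru) mulrA -rnormM mulfV // rnorm1 mul1r mulr1.
  by have := rnorm_ge0 (u x0); lra.
Qed.

Lemma normal_eigenvector_close T w a u : near_rank_one T w ->
  normal_eigenvector T a u -> rnorm (a - w) <= 1 / 8.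
Proof.
move=> Tw [u0 Tu u1]; have := near_rank_one_coord u Tw.
rewrite Tu l2Z u0 !mulr1; have := delta_norm_split u.
by rewrite u0 rnorm1; lra.
Qed.

(** The eigenvalue near [w] is simple and isolated, so it is a Lipschitz function of
    the operator. Comparing two eigenvector equations in the coordinate [x0] bounds
    the difference of the eigenvalues, and comparing them off [x0] bounds the
    difference of the eigenvectors. *)
Lemma normal_eigenvector_stable T T' w w' a a' u u' :
  near_rank_one T w -> near_rank_one T' w' ->
  normal_eigenvector T a u -> normal_eigenvector T' a' u' ->
  rnorm (a - a') <= 3 * rnorm (T - T').
Proof.
move=> Tw Tw' eu eu'; have aw := normal_eigenvector_close Tw eu.
have [u0 Tu u1] := eu; have [u0' Tu' u1'] := eu'; have [w1 _] := Tw.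
set k := rnorm (T - T'); have k0 : 0 <= k by exact: rnorm_ge0.
pose d := u - u'; have d0 : d x0 = 0 by rewrite /d l2D l2N u0 u0' subrr.
pose E : l2 R X := (T d : l2 R X) + ((T - T') u' : l2 R X).
have EE : E = a *: u - a' *: u'.
  by rewrite /E /d bop_atD bop_atN bopD bopN Tu -Tu' addrA subrK.
have hu' : hnorm u' <= 2.
  by have := delta_norm_split u'; rewrite u0' rnorm1; lra.
have hTd : hnorm (T d) <= 1 / 16 * hnorm d.
  have [_ /(_ d)] := Tw; rewrite d0 mulr0.
  by rewrite (_ : delta x0 0 = 0) ?subr0 //; apply: l2_eq => x; rewrite deltaE if_same.
have hE : hnorm E <= 1 / 16 * hnorm d + 2 * k.
  apply: le_trans (hnormD _ _) _; apply: lerD => //.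
  apply: le_trans (opnormP _ _) _; rewrite -rnorm_bop -/k mulrC.
  by rewrite ler_wpM2r.
have aE : rnorm (a - a') <= hnorm E.
  have := coord_le E x0; rewrite EE l2D l2N !l2Z u0 u0' !mulr1.
  exact.
have adE : a *: d = E - (a - a') *: u'.
  by rewrite EE /d scalerBr scalerBl opprB addrA subrK.
have had : rnorm a * hnorm d <= hnorm E + rnorm (a - a') * 2.
  rewrite -hnormZ adE; apply: le_trans (hnormD _ _) _; rewrite hnormN lerD2l.
  by rewrite hnormZ ler_wpM2l ?rnorm_ge0.
have ra : 7 / 8 <= rnorm a.
  by have := rnormD a (- (a - w)); rewrite opprB addrC subrK rnormB w1; lra.
have hd0 := hnorm_ge0 d.
have : 7 / 8 * hnorm d <= rnorm a * hnorm d by rewrite ler_wpM2r.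
lra.
Qed.

End RankOne.

(** * Loops *)

Section GenVertexSets.
Variable G : ultragraph.

Lemma gen_set1 (v : vertex G) : gen_vertex_sets [set v].
Proof. by apply: sub_gen_smallest; left; exists v. Qed.

Lemma gen_rng (e : edge G) : gen_vertex_sets (rng e).
Proof. by apply: sub_gen_smallest; right; exists e. Qed.

Lemma gen_set0 : gen_vertex_sets (set0 : set (vertex G)).
Proof. by move=> M [[]]. Qed.

Lemma gen_setI (X Y : set (vertex G)) :
  gen_vertex_sets X -> gen_vertex_sets Y -> gen_vertex_sets (X `&` Y).
Proof.
move=> gX gY M HM; have [[_ MI _] _] := HM.
by apply: MI; [exact: gX | exact: gY].
Qed.

Lemma gen_setU (X Y : set (vertex G)) :
  gen_vertex_sets X -> gen_vertex_sets Y -> gen_vertex_sets (X `|` Y).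
Proof.
move=> gX gY M HM; have [[_ _ MU] _] := HM.
by apply: MU; [exact: gX | exact: gY].
Qed.

End GenVertexSets.

Section Words.
Variables (R : realType) (G : ultragraph) (A : cstarAlgType R).
Variables (s : edge G -> A) (p : set (vertex G) -> A).

Definition wmul (al : seq (edge G)) (x : A) : A := foldr (fun e y => s e ** y) x al.

Hypothesis CK : CK_family s p.
Implicit Types (e f : edge G) (X Y : set (vertex G)) (al : seq (edge G)).

Lemma CK_src e : p [set src e] ** s e = s e.
Proof.
have h := congr1 star (CK_range CK e).
rewrite !starM starK in h; have [_ ps] := CK_projection CK (gen_set1 (src e)).
rewrite ps in h; have pi := CK_partial_isometry CK e.
by rewrite -{1}pi cmulA h pi.
Qed.

Lemma CK_mem e X : gen_vertex_sets X -> X (src e) -> p X ** s e = s e.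
Proof.
move=> gX Xe; rewrite -{1}CK_src cmulA (CK_setI CK gX (gen_set1 _)).
by rewrite setIidr ?CK_src // => _ ->.
Qed.

Lemma CK_notmem e X : gen_vertex_sets X -> ~ X (src e) -> p X ** s e = 0.
Proof.
move=> gX Xe; rewrite -CK_src cmulA (CK_setI CK gX (gen_set1 _)).
rewrite (_ : _ `&` _ = set0) ?(CK_set0 CK) ?cmul0l //.
by apply/seteqP; split=> // v [Xv ve]; apply: Xe; rewrite -ve.
Qed.

(** [p (rng e)] dominates [p [set w]] and thus fixes [y]. *)
Lemma CK_edge_isometry e y w : p [set w] ** y = y -> rng e w ->
  star (s e ** y) ** (s e ** y) = star y ** y.
Proof.
move=> py ew.
have -> : s e ** y = s e ** (p [set w] ** y) by rewrite py.
rewrite starM -cmulA (cmulA (star (s e))) (CK_source CK) starM.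
have [_ ps] := CK_projection CK (gen_set1 w).
rewrite (cmulA (p (rng e))) (CK_setI CK (gen_rng e) (gen_set1 w)).
rewrite (_ : _ `&` _ = [set w]); last by apply: setIidr => _ ->.
by rewrite -starM py.
Qed.

Lemma path_word_isometry e al a0 :
  path (fun e f => src f \in rng e) e (rcons al a0) ->
  let y := wmul (e :: al) (p [set src a0]) in
  p [set src e] ** y = y /\ star y ** y = p [set src a0].
Proof.
have [pp ps] := CK_projection CK (gen_set1 (src a0)).
elim: al e => [|f al IH] e /=.
  rewrite andbT => /set_mem ea; split; first by rewrite cmulA CK_src.
  by rewrite (CK_edge_isometry pp ea) ps pp.
move=> /andP[/set_mem ef /IH[/= h1 h2]]; split; first by rewrite cmulA CK_src.
by rewrite (CK_edge_isometry h1 ef) h2.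
Qed.

End Words.

Section LoopRepresentation.
Variables (R : realType) (G : ultragraph).
Implicit Types (e f : edge G) (X : set (vertex G)) (al : seq (edge G)).
Implicit Types (x y : path_space G).

Fixpoint starts_with al X x : Prop :=
  if al is e :: al' then paths_through e x /\ starts_with al' X (path_tail x)
  else paths_from X x.

Lemma word_opE al X (u : l2 R (path_space G)) x :
  (wmul (@edge_op R G) al (vertex_op R X) u : l2 R (path_space G)) x =
  if `[< starts_with al X x >] then u (iter (size al) (@path_tail G) x) else 0.
Proof.
elim: al x => [|e al IH] x.
  by rewrite [LHS]dprojE /=; case: asboolP => h; [rewrite mem_set | rewrite memNset].
transitivity (if x \in paths_through e then
  (wmul (@edge_op R G) al (vertex_op R X) u : l2 R (path_space G)) (path_tail x) else 0).
  by [].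
rewrite IH [size _]/= iterSr; case: asboolP => h; case: asboolP => h'.
- by case: h' => /mem_set ->.
- by case: ifPn => // /set_mem xe; case: h'.
- by case: h' => _ /h.
- by rewrite if_same.
Qed.

Lemma starts_withP al a0 X x : starts_with al X x ->
  (forall i, (i < size al)%N -> x i = inr (nth a0 al i)) /\
  paths_from X (iter (size al) (@path_tail G) x).
Proof.
elim: al x => [|e al IH] x //= [[_ x0] /IH[h1 h2]]; rewrite -iterS iterSr.
by split=> // -[|i] //; rewrite ltnS => /h1.
Qed.

Lemma starts_with_intro al a0 X x : boundary_path x ->
  (forall i, (i < size al)%N -> x i = inr (nth a0 al i)) ->
  X (state_vertex (x (size al))) -> starts_with al X x.
Proof.
elim: al x => [|e al IH] x bx xal xX; first by split.
split; first by split=> //; exact: (xal 0%N).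
by apply: IH => // [n|i il]; [exact: bx n.+1 | exact: (xal i.+1)].
Qed.

Lemma iter_tailE n x k : iter n (@path_tail G) x k = x (k + n)%N.
Proof.
by elim: n k => [|n IH] k; rewrite ?addn0 // iterS /path_tail IH addnS addSn.
Qed.

Definition loop_path a0 al : path_space G :=
  fun k => inr (nth a0 (a0 :: al) (k %% (size al).+1)).

Lemma loop_path_boundary a0 al :
  path (fun e f => src f \in rng e) a0 (rcons al a0) ->
  boundary_path (loop_path a0 al).
Proof.
move=> /(pathP a0); rewrite size_rcons => H k; rewrite /loop_path /=.
set n := (size al).+1; set i := (k %% n)%N.
have il : (i < n)%N by rewrite ltn_pmod.
have := H i il; rewrite -rcons_cons !nth_rcons /= -/n il => /set_mem.
congr (rng _ _); congr src.
have -> : (k.+1 %% n = i.+1 %% n)%N by rewrite /i -addn1 -modnDml addn1.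
move: il; rewrite leq_eqVlt => /orP[/eqP E|il'].
  by rewrite E modnn /=; move: E; rewrite /n => -[->]; rewrite ltnn eqxx.
by rewrite modn_small //=; move: il'; rewrite /n ltnS => ->.
Qed.

Lemma loop_path_starts a0 al :
  path (fun e f => src f \in rng e) a0 (rcons al a0) ->
  starts_with (a0 :: al) [set src a0] (loop_path a0 al).
Proof.
move=> loop; apply: (@starts_with_intro _ a0); first exact: loop_path_boundary.
  by move=> i il; rewrite /loop_path modn_small.
by rewrite /loop_path /= modnn.
Qed.

(** By induction on blocks: what remains after the first turn of the loop is again a
    boundary path from its base. *)
Lemma loop_path_unique a0 al :
  (forall y, paths_from [set src a0] y -> starts_with (a0 :: al) [set src a0] y) ->
  forall y, paths_from [set src a0] y -> y = loop_path a0 al.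
Proof.
move=> H y; set n := (size al).+1.
suff K m : forall i, (i < m)%N -> forall y, paths_from [set src a0] y ->
    y i = loop_path a0 al i.
  by move=> fy; apply/funext => i; exact: (K i.+1).
elim: m => // m IH i; rewrite ltnS => im z fz.
have [z1 z2] := starts_withP a0 (H z fz).
have [il|ni] := ltnP i n; first by rewrite z1 // /loop_path modn_small.
have := iter_tailE n z (i - n); rewrite subnK // => <-.
rewrite IH //; last by apply: leq_trans im; rewrite ltn_subrL (leq_trans _ ni).
by rewrite /loop_path -[in RHS](subnK ni) modnDr.
Qed.

End LoopRepresentation.

(** * The gauge circle *)

Section GaugeCircle.
Variable R : realType.
Implicit Types t : R.

Definition unit_circle t : R[i] := Complex (cos t) (sin t).

Lemma rnorm_unit_circle t : rnorm (unit_circle t) = 1.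
Proof.
apply/eqP; rewrite -(@eqrXn2 _ 2) ?rnorm_ge0 //.
by rewrite sqr_rnorm /= cos2Dsin2 expr1n.
Qed.

Lemma unit_circleX t n : unit_circle t ^+ n = unit_circle (t *+ n).
Proof.
elim: n => [|n IH]; first by rewrite expr0 mulr0n /unit_circle cos0 sin0.
rewrite exprS IH mulrS /unit_circle cosD sinD.
by apply/eqP; rewrite eq_complex /=; apply/andP; split; apply/eqP; ring.
Qed.

Lemma unit_circle_continuous t e : 0 < e ->
  \forall u \near t, rnorm (unit_circle u - unit_circle t) < e.
Proof.
move=> e0; have /cvgrPdist_lt/(_ _ (divr_gt0 e0 (ltr0n _ 2))) hc := @continuous_cos R t.
have /cvgrPdist_lt/(_ _ (divr_gt0 e0 (ltr0n _ 2))) hs := @continuous_sin R t.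
apply: filterS2 hc hs => u cu su; rewrite rnormB.
by apply: le_lt_trans (rnorm_le_ReIm _) _; rewrite [e]splitr ltrD.
Qed.

Lemma locally_constant_cst (g : R -> R) :
  (forall t, \forall u \near t, g u = g t) -> forall a b, g a = g b.
Proof.
move=> gloc a b; apply: (@is_derive_0_is_cst R g) => t.
have cst0 : is_derive (t : R^o) 1 (cst (g t) : R^o -> R^o) 0 by exact: is_derive_cst.
by apply: near_eq_is_derive cst0; apply: filterS (gloc t) => u /=.
Qed.

Lemma min_gap (r : seq R[i]) (a : R[i]) :
  exists2 d : R, 0 < d & forall b, b \in r -> rnorm (b - a) < d -> b = a.
Proof.
elim: r => [|c r [d d0 IH]]; first by exists 1.
have [->|ca] := eqVneq c a.
  by exists d => // b; rewrite inE => /orP[/eqP //|]; exact: IH.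
have c0 : 0 < rnorm (c - a).
  rewrite lt_def rnorm_ge0 andbT; apply: contra ca => /eqP/rnorm_eq0/eqP.
  by rewrite subr_eq0.
exists (Num.min d (rnorm (c - a))); first by rewrite lt_min d0.
move=> b; rewrite inE lt_min => /orP[/eqP ->|br] /andP[h1 h2].
  by rewrite ltxx in h2.
exact: IH.
Qed.

End GaugeCircle.

Section GaugeRepresentations.
Variables (R : realType) (G : ultragraph) (A : cstarAlgType R).
Variables (s : edge G -> A) (p : set (vertex G) -> A).
Local Notation H := (l2_hilbert R (path_space G)).

Definition gauge_rep (t : R) (f : {linear A -> bop H}) : Prop :=
  [/\ star_morphism f, forall e, f (s e) = unit_circle t *: edge_op R e
    & forall X, gen_vertex_sets X -> f (p X) = vertex_op R X].

Lemma gauge_rep_word t f al X : gauge_rep t f -> gen_vertex_sets X ->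
  f (wmul s al (p X)) =
  unit_circle t ^+ size al *: wmul (@edge_op R G) al (vertex_op R X).
Proof.
move=> [fs fe fp] gX; elim: al => [|e al IH] /=; first by rewrite expr0 scale1r fp.
by rewrite (morphM fs) IH fe cmulZl cmulZr scalerA exprS.
Qed.

(** The elements whose images depend continuously on the phase form a closed
    star-subalgebra, since representations are contractive, and it contains the
    generators. *)
Lemma gauge_continuous (f : R -> {linear A -> bop H}) (a : A) :
  generated_cstar_subalgebra (range s `|` p @` @gen_vertex_sets G) = setT ->
  (forall t, gauge_rep t (f t)) ->
  forall t e, 0 < e -> \forall u \near t, rnorm (f u a - f t a) < e.
Proof.
move=> gen frep.
pose S := [set a | forall t e, 0 < e -> \forall u \near t, rnorm (f u a - f t a) < e].
suff : S a by [].
have : generated_cstar_subalgebra (range s `|` p @` @gen_vertex_sets G) a by rewrite gen.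
apply; split; last first.
  move=> x [[e _ <-]|[X gX <-]] t d d0; last first.
    have [_ _ fp] := frep t; apply: (@filterE _ (nbhs t)) => u; have [_ _ fp'] := frep u.
    by rewrite fp // fp' // subrr rnorm0.
  have D : 0 < rnorm (edge_op R e) + 1 by rewrite ltr_wpDl ?rnorm_ge0.
  apply: filterS (unit_circle_continuous t (divr_gt0 d0 D)) => u ut.
  have [_ fe _] := frep t; have [_ fe' _] := frep u.
  rewrite fe fe' -scalerBl rnormZ; rewrite ltr_pdivlMr // in ut.
  apply: le_lt_trans ut; rewrite ler_wpM2l ?rnorm_ge0 //.
  by rewrite lerDl.
have fs t : star_morphism (f t) by have [] := frep t.
split.
  split.
  - by move=> t e e0; apply: (@filterE _ (nbhs t)) => u; rewrite (linear0 (f u)) (linear0 (f t)) subrr rnorm0.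
  - move=> c x y Sx Sy t e e0.
    have C : 0 < rnorm c + 1 by rewrite ltr_wpDl ?rnorm_ge0.
    have e1 : 0 < e / 2 / (rnorm c + 1) by rewrite !divr_gt0.
    apply: filterS2 (Sx t _ e1) (Sy t _ (divr_gt0 e0 (ltr0n _ 2))) => u ux uy.
    rewrite (linearP (f u)) (linearP (f t)) opprD addrACA -scalerBr.
    apply: le_lt_trans (rnormD _ _) _; rewrite [e]splitr rnormZ.
    apply: ler_ltD uy; rewrite ltr_pdivlMr // in ux.
    apply: ltW; apply: le_lt_trans ux; rewrite mulrC ler_wpM2l ?rnorm_ge0 //.
    by rewrite lerDl.
  - move=> x y Sx Sy t e e0.
    have C z : 0 < rnorm (z : A) + 1 by rewrite ltr_wpDl ?rnorm_ge0.
    have e1 z : 0 < e / 2 / (rnorm (z : A) + 1) by rewrite !divr_gt0.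
    apply: filterS2 (Sx t _ (e1 y)) (Sy t _ (e1 x)) => u ux uy.
    rewrite !(morphM (fs _)).
    have -> : f u x ** f u y - f t x ** f t y =
        (f u x - f t x) ** f u y + f t x ** (f u y - f t y).
      by rewrite cmulDl cmulDr cmulNl cmulNr addrA subrK.
    apply: le_lt_trans (rnormD _ _) _; rewrite [e]splitr.
    rewrite (ltr_pdivlMr _ _ (C y)) in ux; rewrite (ltr_pdivlMr _ _ (C x)) in uy.
    apply: ltrD.
      apply: le_lt_trans (rnorm_cmul _ _) _; apply: le_lt_trans ux.
      rewrite ler_wpM2l ?rnorm_ge0 //; apply: le_trans (rnorm_morph (fs u) y) _.
      by rewrite lerDl.
    apply: le_lt_trans (rnorm_cmul _ _) _; apply: le_lt_trans uy.
    rewrite mulrC ler_wpM2l ?rnorm_ge0 //; apply: le_trans (rnorm_morph (fs t) x) _.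
    by rewrite lerDl.
  - move=> x Sx t e e0; apply: filterS (Sx t e e0) => u ux.
    by rewrite !(morph_star (fs _)) -starN -starD rnorm_star.
move=> x clx t e e0.
have e3 : 0 < e / 3 by rewrite divr_gt0.
have -> : e = e / 3 + (e / 3 + e / 3) by lra.
have [y Sy xy] := closure_rnorm clx e3.
apply: filterS (Sy t _ e3) => u uy.
have near v : rnorm (f v x - f v y) < e / 3.
  by rewrite -linearB; apply: le_lt_trans (rnorm_morph (fs v) _) xy.
apply: le_lt_trans (rnorm_dist _ (f u y) _) _.
apply: le_lt_trans (lerD (lexx _) (rnorm_dist _ (f t y) _)) _.
apply: ltrD; first exact: near.
apply: ltrD; first exact: uy.
by have neart := near t; rewrite (rnormB (f t y) (f t x)); exact: neart.
Qed.

End GaugeRepresentations.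

Lemma l2_dot_delta0 (R : realType) (X : choiceType) (u : l2 R X) (y : X) (c : R[i]) :
  u y = 0 -> l2_dot u (delta y c) = 0.
Proof.
move=> uy; rewrite /l2_dot; have -> : sqtot (u + delta y c) = sqtot (u - delta y c).
  congr tot; apply/funext => x; rewrite !l2D l2N deltaE.
  by case: eqVneq => [->|_]; rewrite ?uy ?add0r ?sqnN // oppr0.
by rewrite subrr mul0r.
Qed.

Section LoopNotAF.
Variables (R : realType) (G : ultragraph) (A : cstarAlgType R).
Variables (s : edge G -> A) (p : set (vertex G) -> A).
Hypothesis hA : is_CstarG s p.
Hypothesis AFA : AF A.
Variables (a0 : edge G) (al : seq (edge G)).
Hypothesis loop : path (fun e f => src f \in rng e) a0 (rcons al a0).

Local Notation H := (l2_hilbert R (path_space G)).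
Local Notation v := [set src a0].
Local Notation n := (size al).+1.
Let S : A := wmul s (a0 :: al) (p v).
Let W : bop H := wmul (@edge_op R G) (a0 :: al) (vertex_op R v).

Lemma gauge_rep_exists : exists f : R -> {linear A -> bop H}, forall t, gauge_rep s p t (f t).
Proof.
suff /choice[f Hf] : forall t, exists f : {linear A -> bop H}, gauge_rep s p t f.
  by exists f.
move=> t; have [f [fs fe fp]] :=
  CstarG_universal hA (gauge_family G (rnorm_unit_circle t)).
by exists f.
Qed.

(** Otherwise the point mass at [y] is orthogonal to the range of the isometry
    [s + 1 - p_v] of the loop, contrary to [AF_isometry_dense_range]. *)
Lemma AF_starts_with y : paths_from v y -> starts_with (a0 :: al) v y.
Proof.
move=> yv; apply: contrapT => yal.
have [f frep] := gauge_rep_exists; have [fstar _ fp] := frep 0.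
have CK := CstarG_family hA.
have [PS SS] := path_word_isometry CK loop.
have d0 : delta y 1 = 0 :> H.
  apply: (AF_isometry_dense_range AFA fstar _ SS PS).
    exact: (CK_projection CK (gen_set1 (src a0))).
  move=> u; apply: l2_dot_delta0; rewrite l2D l2D l2N.
  rewrite (gauge_rep_word (a0 :: al) (frep 0) (gen_set1 (src a0))) bopZ l2Z word_opE.
  case: asboolP => // _; rewrite mulr0 add0r fp; last exact: gen_set1.
  by rewrite dprojE mem_set // subrr.
have := congr1 (@hnorm R H) d0; rewrite hnorm_delta rnorm1 hnorm0 => /eqP.
by rewrite oner_eq0.
Qed.

Let x0 := loop_path a0 al.

(** Now the loop is the only boundary path from its base, so the word of the loop
    acts as the projection onto the point mass at that path. *)
Lemma W_rank_one (u : l2 R (path_space G)) : W u = delta x0 (u x0) :> l2 R _.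
Proof.
have x0v : paths_from v x0.
  split; first exact: loop_path_boundary.
  by rewrite /x0 /loop_path mod0n.
have uniq := loop_path_unique AF_starts_with.
apply: l2_eq => x; rewrite deltaE word_opE; case: asboolP => h.
  have xv : paths_from v x by case: h => [[bx xa] _]; split=> //; rewrite xa.
  have [_ tv] := starts_withP a0 h.
  by rewrite (uniq _ tv) (uniq _ xv) eqxx.
case: eqVneq => // xx0; case: h; rewrite xx0; exact: loop_path_starts.
Qed.

Lemma loop_not_AF : False.
Proof.
have [f frep] := gauge_rep_exists.
have fstar t : star_morphism (f t) by have [] := frep t.
have e0 : 0 < 1 / 16 :> R by [].
have [F [FS Ffin [t [_ [Ft _ St _]]]]] := AF_approx S S AFA e0.
have [m m0 mT] := finite_dim_algebraic FS Ffin Ft.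
have fS r (u : l2 R (path_space G)) :
    f r S u = delta x0 (unit_circle r ^+ n * u x0) :> l2 R _.
  rewrite (gauge_rep_word (a0 :: al) (frep r) (gen_set1 (src a0))) bopZ W_rank_one.
  by apply: l2_eq => x; rewrite l2Z !deltaE; case: ifP; rewrite ?mulr0.
have near r : near_rank_one x0 (f r t) (unit_circle r ^+ n).
  split; first by rewrite rnormX rnorm_unit_circle expr1n.
  move=> u; rewrite -fS.
  have -> : (f r t u - f r S u : H) = f r (t - S) u by rewrite linearB.
  apply: le_trans (hnorm_morph_le (fstar r) _ _) _.
  by rewrite ler_wpM2r ?hnorm_ge0 // rnormB ltW.
have /choice[lam lamP] r : exists a, root m a /\ exists u,
    normal_eigenvector x0 (f r t) a u.
  have [a [u [ma au]]] := near_rank_one_eigen (near r) m0 (mT _ _ (fstar r)).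
  by exists a; split=> //; exists u.
have lam_close r : rnorm (lam r - unit_circle r ^+ n) <= 1 / 8.
  by have [_ [u hu]] := lamP r; exact: normal_eigenvector_close (near r) hu.
have [rs mE] := closed_field_poly_normal m.
have lam_rs r : lam r \in rs.
  have [+ _] := lamP r.
  by rewrite mE rootZ ?lead_coef_eq0 // root_prod_XsubC.
(* The eigenvalue moves continuously in a finite set of roots. *)
have lam_loc r : \forall r' \near r, Re (lam r') = Re (lam r).
  have [d d0 dP] := min_gap rs (lam r).
  have cont := gauge_continuous t (CstarG_generated hA) frep r (divr_gt0 d0 (ltr0n _ 3)).
  apply: filterS cont => r' hr'; congr Re; apply: dP => //.
  have [_ [u hu]] := lamP r; have [_ [u' hu']] := lamP r'.
  apply: le_lt_trans (normal_eigenvector_stable (near r') (near r) hu' hu) _.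
  by rewrite mulrC -ltr_pdivlMr.
have := locally_constant_cst lam_loc 0 (pi / n%:R).
have h0 := lam_close 0; have h1 := lam_close (pi / n%:R).
rewrite unit_circleX mul0rn in h0.
have piE : pi / n%:R *+ n = pi :> R by rewrite -[LHS]mulr_natr divfK ?pnatr_eq0.
rewrite unit_circleX piE in h1.
have r0 := le_trans (Re_le_rnorm _) h0; have r1 := le_trans (Re_le_rnorm _) h1.
move: r0 r1; rewrite /unit_circle cos0 sin0 cospi sinpi.
have ReB (c d : R[i]) : Re (c - d) = Re c - Re d by case: c d => ? ? [].
rewrite !ReB !ler_norml /= => /andP[r0 _] /andP[_ r1]; lra.
Qed.

End LoopNotAF.

Lemma AF_no_loop (R : realType) (G : ultragraph) (A : cstarAlgType R)
    (s : edge G -> A) (p : set (vertex G) -> A) :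
  is_CstarG s p -> AF A -> ~ exists a : seq (edge G), is_loop a.
Proof.
move=> hA AFA [[|a0 al] [nonempty loop]]; first by case: nonempty.
exact: (loop_not_AF hA AFA loop).
Qed.

(** * Ultragraphs without loops *)

Section ClosedSubalgebras.
Variables (R : realType) (A : cstarAlgType R).
Implicit Types (x y : A) (S : set A).

Lemma rnorm_closure S x : (forall e, 0 < e -> exists2 y, S y & rnorm (x - y) < e) ->
  closure S x.
Proof.
move=> H B /nbhs_ballP[r r0 Br].
have [e re] : exists e : R, r = e%:C.
  by exists (Re r); rewrite RRe_real // gtr0_real.
move: r0 => /=; rewrite re -(rmorph0 (real_complex R)) ltcR => e0.
have [y Sy xy] := H e e0; exists y; split=> //; apply: Br.
by rewrite re -ball_normE /= rnorm_lt.
Qed.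

Lemma closure_star_subalgebra S : star_subalgebra S -> star_subalgebra (closure S).
Proof.
move=> [S0 SL SM Sst]; split.
- exact: subset_closure.
- move=> c x y Sx Sy; apply: rnorm_closure => e e0.
  have C : 0 < rnorm c + 1 by rewrite ltr_wpDl ?rnorm_ge0.
  have e1 : 0 < e / 2 / (rnorm c + 1) by rewrite !divr_gt0.
  have [x' Sx' xx] := closure_rnorm Sx e1.
  have [y' Sy' yy] := closure_rnorm Sy (divr_gt0 e0 (ltr0n _ 2)).
  exists (c *: x' + y'); first exact: SL.
  rewrite opprD addrACA -scalerBr; apply: le_lt_trans (rnormD _ _) _.
  rewrite [e]splitr rnormZ; apply: ler_ltD yy.
  rewrite (ltr_pdivlMr _ _ C) in xx; apply: ltW; apply: le_lt_trans xx.
  by rewrite mulrC ler_wpM2l ?rnorm_ge0 // lerDl.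
- move=> x y Sx Sy; apply: rnorm_closure => e e0.
  have C : 0 < rnorm x + rnorm y + 1 by rewrite ltr_wpDl ?addr_ge0 ?rnorm_ge0.
  pose d := Num.min 1 (e / (rnorm x + rnorm y + 1)).
  have d0 : 0 < d by rewrite lt_min ltr01 divr_gt0.
  have d1 : d <= 1 by rewrite ge_min lexx.
  have de : d * (rnorm x + rnorm y + 1) <= e.
    by rewrite -ler_pdivlMr // ge_min lexx orbT.
  have [x' Sx' xx] := closure_rnorm Sx d0.
  have [y' Sy' yy] := closure_rnorm Sy d0.
  exists (x' ** y'); first exact: SM.
  have -> : x ** y - x' ** y' = (x - x') ** y + x' ** (y - y').
    by rewrite cmulDl cmulDr cmulNl cmulNr addrA subrK.
  apply: le_lt_trans (rnormD _ _) _; apply: lt_le_trans de.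
  have h1 := rnorm_cmul (x - x') y; have h2 := rnorm_cmul x' (y - y').
  have h3 : rnorm x' <= rnorm x + 1.
    rewrite -[x'](subrK x) addrC; apply: le_trans (rnormD _ _) _.
    by rewrite lerD2l rnormB ltW // (lt_le_trans xx).
  have h4 : rnorm (x - x') * rnorm y <= d * rnorm y.
    by rewrite ler_wpM2r ?rnorm_ge0 // ltW.
  have h5 : rnorm x' * rnorm (y - y') < (rnorm x + 1) * d.
    apply: (@le_lt_trans _ _ ((rnorm x + 1) * rnorm (y - y'))).
      by rewrite ler_wpM2r ?rnorm_ge0.
    by rewrite ltr_pM2l // ltr_wpDl ?rnorm_ge0.
  move: h1 h2 h4 h5.
  move: (rnorm (_ ** _)) (rnorm (_ ** _)) (_ * rnorm y) (_ * rnorm (y - y')).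
  move=> a b a' b' h1 h2 h4 h5; rewrite (_ : d * _ = d * rnorm y + (rnorm x + 1) * d).
    by apply: ler_ltD; [apply: le_trans h4 | apply: le_lt_trans h5].
  by ring.
- move=> x Sx; apply: rnorm_closure => e e0.
  have [x' Sx' xx] := closure_rnorm Sx e0; exists (star x'); first exact: Sst.
  by rewrite -starN -starD rnorm_star.
Qed.

End ClosedSubalgebras.

Section LinSpan.
Variables (R : realType) (A : cstarAlgType R).
Implicit Types (W : seq A) (x y : A).

Definition lin_span W : set A :=
  [set x | exists c : 'I_(size W) -> R[i], x = \sum_(i < size W) c i *: W`_i].

Lemma lin_span_finite_dim W : finite_dimensional (lin_span W).
Proof. by exists (size W), (fun i => W`_i). Qed.

Lemma lin_span0 W : lin_span W 0.
Proof. by exists (fun=> 0); rewrite big1 // => i _; rewrite scale0r. Qed.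

Lemma lin_span_linear W c x y : lin_span W x -> lin_span W y -> lin_span W (c *: x + y).
Proof.
move=> [a ->] [b ->]; exists (fun i => c * a i + b i).
rewrite scaler_sumr -big_split; apply: eq_bigr => i _.
by rewrite scalerDl scalerA.
Qed.

Lemma lin_span_mem W x : x \in W -> lin_span W x.
Proof.
move=> xW; have iW : (index x W < size W)%N by rewrite index_mem.
exists (fun i => if i == Ordinal iW then 1 else 0).
rewrite (bigD1 (Ordinal iW)) //= eqxx scale1r nth_index // big1 ?addr0 //.
by move=> i /negPf ->; rewrite scale0r.
Qed.

Lemma lin_span_ind W (S : set A) : S 0 ->
  (forall c x y, S x -> S y -> S (c *: x + y)) ->
  (forall x, x \in W -> S x) -> lin_span W `<=` S.
Proof.
move=> S0 SL SW x [c ->]; apply: (big_ind S) => //.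
- by move=> a b Sa Sb; rewrite -[a]scale1r; exact: SL.
- by move=> i _; rewrite -[_ *: _]addr0; apply: SL => //; apply: SW; exact: mem_nth.
Qed.

End LinSpan.

Section IntersectionClosure.
Variable T : Type.
Implicit Types (X Y Z : set T) (l : seq (set T)).

(** Only nonempty families are intersected, because the set of all vertices need not
    belong to [gen_vertex_sets]. *)
Definition inter_closure l : seq (set T) :=
  foldr (fun X acc => X :: acc ++ [seq X `&` Y | Y <- acc]) [::] l.

(** Together with [mem_inter_closure] and [inter_closureI], this characterizes the
    list by its members. *)
Lemma inter_closure_ind l (P : set T -> Prop) :
  (forall X, X \in l -> P X) -> (forall X Y, P X -> P Y -> P (X `&` Y)) ->
  forall Y, Y \in inter_closure l -> P Y.
Proof.
move=> Pl PI; elim: l Pl => [|X l IH] Pl Y //=.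
have PX : P X by apply: Pl; rewrite inE eqxx.
have Pacc Z : Z \in inter_closure l -> P Z.
  by apply: IH => // Z' Zl; apply: Pl; rewrite inE Zl orbT.
rewrite inE mem_cat => /or3P[/eqP -> //|/Pacc //|/mapP[Z /Pacc PZ ->]].
exact: PI.
Qed.

Lemma mem_inter_closure l X : X \in l -> X \in inter_closure l.
Proof.
elim: l => [//|Z l IH] /=; rewrite !inE mem_cat.
by case/orP => [->//|/IH ->]; rewrite orbT.
Qed.

Lemma inter_closureI l X Y : X \in inter_closure l -> Y \in inter_closure l ->
  X `&` Y \in inter_closure l.
Proof.
elim: l X Y => [//|Z l IH] X Y /=; set acc := inter_closure l.
have mapI V : V \in acc -> Z `&` V \in [seq Z `&` Y | Y <- acc] by move=> ?; exact: map_f.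
rewrite !inE !mem_cat.
case/or3P => [/eqP ->|Xa|/mapP[X' Xa ->]]; case/or3P => [/eqP ->|Ya|/mapP[Y' Ya ->]].
- by rewrite setIid eqxx.
- by rewrite (mapI _ Ya) !orbT.
- by rewrite setIA setIid (mapI _ Ya) !orbT.
- by rewrite setIC (mapI _ Xa) !orbT.
- by rewrite (IH _ _ Xa Ya) orbT.
- by rewrite setICA (mapI _ (IH _ _ Xa Ya)) !orbT.
- by rewrite setIAC setIid (mapI _ Xa) !orbT.
- by rewrite -setIA (mapI _ (IH _ _ Xa Ya)) !orbT.
- by rewrite setIACA setIid (mapI _ (IH _ _ Xa Ya)) !orbT.
Qed.

End IntersectionClosure.

Section WordCalculus.
Variables (R : realType) (G : ultragraph) (A : cstarAlgType R).
Variables (s : edge G -> A) (p : set (vertex G) -> A).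
Hypothesis CK : CK_family s p.
Implicit Types (e f : edge G) (X Y Z : set (vertex G)) (al be : seq (edge G)).
Implicit Types (x y : A) (E : seq (edge G)).
Local Notation wm := (wmul s).

Lemma wmulA al x y : wm al (x ** y) = wm al x ** y.
Proof. by elim: al => [//|e al IH] /=; rewrite IH cmulA. Qed.

Lemma wmul0 al : wm al 0 = 0.
Proof. by elim: al => [//|e al IH] /=; rewrite IH cmul0r. Qed.

Lemma CK_edge_rng e : s e ** p (rng e) = s e.
Proof. by rewrite -(CK_source CK) cmulA (CK_partial_isometry CK). Qed.

Lemma CK_edge_orthogonal e f : e <> f -> star (s e) ** s f = 0.
Proof.
move=> ef; have pi := CK_partial_isometry CK.
have h := congr1 (fun z => star (s e) ** z ** s f) (CK_orthogonal_ranges CK ef).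
move: h; rewrite /= cmul0r cmul0l => h.
have pistar : star (s e) ** s e ** star (s e) = star (s e).
  by have := congr1 star (pi e); rewrite !starM starK cmulA.
by rewrite -pistar -(pi f) -[RHS]h !cmulA.
Qed.

Lemma wmul_path al x : wm al x <> 0 -> sorted (fun e f => src f \in rng e) al.
Proof.
elim: al => [//|e [//|f al] IH] /= nz; apply/andP; split; last first.
  by apply: IH => h; apply: nz; move: h => /= ->; rewrite cmul0r.
apply: contrapT => /negP; move=> /negP ef; apply: nz.
rewrite -CK_edge_rng -cmulA (cmulA (p _)) (CK_notmem CK (gen_rng e)).
  by rewrite cmul0l cmul0r.
by move=> /mem_set h; rewrite h in ef.
Qed.

Lemma no_loop_uniq al : ~ (exists a : seq (edge G), is_loop a) ->
  sorted (fun e f => src f \in rng e) al -> uniq al.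
Proof.
move=> noloop; elim: al => [//|e al IH] /= pal.
rewrite IH ?(path_sorted pal) // andbT; apply/negP => eal; apply: noloop.
case/splitPr: eal pal => al1 al2; rewrite -cat_rcons cat_path => /andP[pal _].
by exists (e :: al1).
Qed.

(** A nonzero word is a path, and a path that is longer than the list of available
    edges repeats one of them, which closes a loop. *)
Lemma long_word0 al E x : ~ (exists a : seq (edge G), is_loop a) ->
  {subset al <= E} -> (size E < size al)%N -> wm al x = 0.
Proof.
move=> noloop alE sz; apply: contrapT => /wmul_path/(no_loop_uniq noloop) ual.
by have := uniq_leq_size ual alE; rewrite leqNgt sz.
Qed.

(** This is [s_al p_Y s_be^*]. *)
Definition mono al Y be : A := wm al (star (wm be (p Y))).

Lemma star_mono al Y be : star (p Y) = p Y -> star (mono al Y be) = mono be Y al.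
Proof.
move=> sY; rewrite /mono; elim: be => [|e be IH] /=; first by rewrite sY.
by rewrite starM wmulA starM starK IH.
Qed.

End WordCalculus.

Section NoLoopAF.
Variables (R : realType) (G : ultragraph) (A : cstarAlgType R).
Variables (s : edge G -> A) (p : set (vertex G) -> A).
Hypothesis CK : CK_family s p.
Hypothesis noloop : ~ exists a : seq (edge G), is_loop a.
Implicit Types (e f : edge G) (X Y Z : set (vertex G)) (al be : seq (edge G)).
Implicit Types (x y w : A).

Fixpoint words (E : seq (edge G)) n : seq (seq (edge G)) :=
  if n is n'.+1 then [::] :: [seq e :: al | e <- E, al <- words E n'] else [:: [::]].

Lemma mem_words E n al : (al \in words E n) = (size al <= n)%N && all (mem E) al.
Proof.
elim: n al => [|n IH] [|e al] //=; rewrite inE /= ltnS.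
apply/allpairsP/idP => [[[f be] /= [fE beW [-> ->]]]|/and3P[sz eE alE]].
  by move: beW; rewrite IH fE => /andP[-> ->].
by exists (e, al); rewrite /= IH sz alE.
Qed.

(** The bound [n] on the lengths makes the list finite; the monomials that it
    leaves out vanish as soon as [n] is at least the number of edges. *)
Definition monos E (I : seq (set (vertex G))) n : seq A :=
  [seq mono s p ab.1 Y ab.2 | ab <- [seq (al, be) | al <- words E n, be <- words E n],
                              Y <- I].

Lemma mem_monos E I n al Y be : al \in words E n -> be \in words E n -> Y \in I ->
  mono s p al Y be \in monos E I n.
Proof.
move=> alE beE YI; apply/allpairsP; exists ((al, be), Y); split=> //=.
by apply/allpairsP; exists (al, be).
Qed.

Lemma monosP E I n w : w \in monos E I n -> exists al Y be,
  [/\ al \in words E n, be \in words E n, Y \in I & w = mono s p al Y be].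
Proof.
case/allpairsP => [[[al be] Y] /= [/allpairsP[[a b] /= [aW bW [-> ->]]] YI ->]].
by exists a, Y, b.
Qed.

Section Stage.
Variables (E : seq (edge G)) (l : seq (set (vertex G))) (n : nat).
Hypothesis Esize : (size E <= n)%N.
Hypothesis lgen : forall X, X \in l -> gen_vertex_sets X.
Hypothesis Erng : forall e, e \in E -> rng e \in l.
Local Notation I := (inter_closure l).
Local Notation F := (lin_span (monos E I n)).

Let Igen Y : Y \in I -> gen_vertex_sets Y.
Proof. by apply: inter_closure_ind => // X X'; exact: gen_setI. Qed.

Let Ierng e : e \in E -> rng e \in I.
Proof. by move=> /Erng; exact: mem_inter_closure. Qed.

Let starp Y : Y \in I -> star (p Y) = p Y.
Proof. by move=> /Igen gY; have [] := CK_projection CK gY. Qed.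

Lemma mono_span al Y be : all (mem E) al -> all (mem E) be -> Y \in I ->
  F (mono s p al Y be).
Proof.
move=> alE beE YI; have sub (ga : seq (edge G)) : all (mem E) ga -> {subset ga <= E}.
  by move=> /allP.
have [szal|szal] := leqP (size al) n; last first.
  rewrite /mono (long_word0 CK _ noloop (sub _ alE)); first exact: lin_span0.
  exact: leq_ltn_trans szal.
have [szbe|szbe] := leqP (size be) n; last first.
  rewrite /mono (long_word0 CK _ noloop (sub _ beE)); last exact: leq_ltn_trans szbe.
  by rewrite star0 wmul0; exact: lin_span0.
by apply/lin_span_mem/mem_monos; rewrite ?mem_words ?szal ?szbe.
Qed.

Lemma vertex_mul_mono Z al Y be : Z \in I -> all (mem E) al -> all (mem E) be ->
  Y \in I -> F (p Z ** mono s p al Y be).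
Proof.
move=> ZI alE beE YI; case: al alE => [|f al] alE.
  rewrite /mono /= -(starp ZI) -starM -wmulA (CK_setI CK (Igen YI) (Igen ZI)).
  by apply: (@mono_span [::]) => //; exact: inter_closureI.
rewrite /mono /= cmulA; have [fZ|fZ] := pselect (Z (src f)).
  by rewrite (CK_mem CK (Igen ZI) fZ); exact: (@mono_span (f :: al)).
by rewrite (CK_notmem CK (Igen ZI) fZ) cmul0l; exact: lin_span0.
Qed.

Lemma edge_mul_mono e al Y be : e \in E -> all (mem E) al -> all (mem E) be ->
  Y \in I -> F (s e ** mono s p al Y be).
Proof.
move=> eE alE beE YI; apply: (@mono_span (e :: al)) => //=.
by rewrite alE andbT.
Qed.

(** Unless the word [al] is empty, [star (s e)] cancels its first letter or kills
    it; if it is empty, [star (s e)] is absorbed on the right. *)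
Lemma star_edge_mul_mono e al Y be : e \in E -> all (mem E) al -> all (mem E) be ->
  Y \in I -> F (star (s e) ** mono s p al Y be).
Proof.
move=> eE alE beE YI; case: al alE => [|f al] /= alE.
  rewrite /mono /= -starM -wmulA; have [eY|eY] := pselect (Y (src e)).
    rewrite (CK_mem CK (Igen YI) eY) -(CK_edge_rng CK) -[s e ** _]/(wmul s [:: e] _).
    rewrite -[wmul s be _](foldr_cat (fun e y => s e ** y)).
    apply: (@mono_span [::] _ (be ++ [:: e])) => //=; last exact: Ierng.
    by rewrite all_cat beE /= eE.
  by rewrite (CK_notmem CK (Igen YI) eY) wmul0 star0; exact: lin_span0.
have /andP[fE alE'] := alE.
rewrite /mono /= cmulA; have [->|ef] := eqVneq e f.
  by rewrite (CK_source CK); apply: vertex_mul_mono => //; exact: Ierng.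
rewrite (CK_edge_orthogonal CK); last exact/eqP.
by rewrite cmul0l; exact: lin_span0.
Qed.

Lemma mul_span g : (forall al Y be, all (mem E) al -> all (mem E) be -> Y \in I ->
    F (g ** mono s p al Y be)) -> forall x, F x -> F (g ** x).
Proof.
move=> Fg; apply: lin_span_ind => [|c x y Fx Fy|x /monosP[al [Y [be [alW beW YI ->]]]]].
- by rewrite cmul0r; exact: lin_span0.
- by rewrite cmulDr cmulZr; exact: lin_span_linear.
- by move: alW beW; rewrite !mem_words => /andP[_ alE] /andP[_ beE]; exact: Fg.
Qed.

(** A monomial is a product of generators, each of which preserves the span. *)
Lemma mono_mul_span al Y be x : all (mem E) al -> all (mem E) be -> Y \in I ->
  F x -> F (mono s p al Y be ** x).
Proof.
move=> alE beE YI; rewrite /mono; elim: al alE x => [|e al IH] /= alE x Fx.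
  elim: be beE x Fx => [|e be IH] /= beE x Fx.
    by rewrite starp //; apply: mul_span Fx => *; exact: vertex_mul_mono.
  have /andP[eE beE'] := beE; rewrite starM -cmulA; apply: IH => //.
  by apply: mul_span Fx => *; exact: star_edge_mul_mono.
have /andP[eE alE'] := alE; rewrite -cmulA; have {}Fx := IH alE' x Fx.
by apply: mul_span Fx => *; exact: edge_mul_mono.
Qed.

Lemma stage_star_subalgebra : star_subalgebra F.
Proof.
split.
- exact: lin_span0.
- exact: lin_span_linear.
- move=> x y Fx Fy; move: x Fx.
  apply: lin_span_ind => [|c x x' Fx Fx'|x /monosP[al [Y [be [alW beW YI ->]]]]].
  + by rewrite cmul0l; exact: lin_span0.
  + by rewrite cmulDl cmulZl; exact: lin_span_linear.
  + by move: alW beW; rewrite !mem_words => /andP[_ alE] /andP[_ beE];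
      exact: mono_mul_span.
- apply: lin_span_ind => [|c x x' Fx Fx'|x /monosP[al [Y [be [alW beW YI ->]]]]].
  + by rewrite star0; exact: lin_span0.
  + by rewrite starD starZ; exact: lin_span_linear.
  + rewrite star_mono; last exact: starp.
    by apply/lin_span_mem/mem_monos.
Qed.

End Stage.

Definition edges_upto n : seq (edge G) := pmap (@unpickle (edge G)) (iota 0 n).

Definition sets_upto n : seq (set (vertex G)) :=
  [seq [set v] | v <- pmap (@unpickle (vertex G)) (iota 0 n)] ++
  [seq rng e | e <- edges_upto n].

Definition stage n : set A :=
  lin_span (monos (edges_upto n) (inter_closure (sets_upto n)) n).

Lemma pmap_unpickle_sub (T : countType) m n : (m <= n)%N ->
  {subset pmap (@unpickle T) (iota 0 m) <= pmap (@unpickle T) (iota 0 n)}.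
Proof.
move=> mn x; rewrite -(subnKC mn) iotaD pmap_cat mem_cat => ->.
by [].
Qed.

Lemma pmap_unpickle_mem (T : countType) (x : T) n : (pickle x < n)%N ->
  x \in pmap unpickle (iota 0 n).
Proof.
move=> xn; rewrite mem_pmap; apply/mapP; exists (pickle x); last by rewrite pickleK.
by rewrite mem_iota.
Qed.

Lemma size_edges_upto n : (size (edges_upto n) <= n)%N.
Proof. by rewrite size_pmap (leq_trans (count_size _ _)) // size_iota. Qed.

Lemma sets_upto_gen n X : X \in sets_upto n -> gen_vertex_sets X.
Proof.
rewrite mem_cat => /orP[/mapP[v _ ->]|/mapP[e _ ->]]; first exact: gen_set1.
exact: gen_rng.
Qed.

Lemma sets_upto_rng n e : e \in edges_upto n -> rng e \in sets_upto n.
Proof. by move=> eE; rewrite mem_cat map_f ?orbT. Qed.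

Lemma stage_subalgebra n : star_subalgebra (stage n).
Proof.
apply: stage_star_subalgebra; first exact: size_edges_upto.
  exact: sets_upto_gen.
exact: sets_upto_rng.
Qed.

Lemma sets_upto_sub m n : (m <= n)%N -> {subset sets_upto m <= sets_upto n}.
Proof.
move=> mn X; rewrite !mem_cat => /orP[/mapP[v vm ->]|/mapP[e em ->]].
  by rewrite map_f //; exact: pmap_unpickle_sub vm.
by rewrite map_f ?orbT //; exact: pmap_unpickle_sub em.
Qed.

Lemma stage_mono m n : (m <= n)%N -> stage m `<=` stage n.
Proof.
move=> mn; apply: lin_span_ind; [exact: lin_span0 | exact: lin_span_linear|].
move=> x /monosP[al [Y [be [alW beW YI ->]]]]; apply: lin_span_mem.
have wsub ga : ga \in words (edges_upto m) m -> ga \in words (edges_upto n) n.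
  rewrite !mem_words => /andP[sz /allP gaE]; rewrite (leq_trans sz mn) /=.
  by apply/allP => e /gaE; exact: pmap_unpickle_sub.
apply: mem_monos; [exact: wsub | exact: wsub|].
move: Y YI; apply: inter_closure_ind => [X XI|X X']; last exact: inter_closureI.
by apply: mem_inter_closure; exact: sets_upto_sub XI.
Qed.

Lemma stage_union_subalgebra : star_subalgebra (\bigcup_n stage n).
Proof.
have up m n x : stage m x -> stage (maxn m n) x by apply: stage_mono; exact: leq_maxl.
have up' m n x : stage n x -> stage (maxn m n) x by apply: stage_mono; exact: leq_maxr.
split.
- by exists 0%N => //; exact: lin_span0.
- move=> c x y [m _ mx] [n _ ny]; exists (maxn m n) => //.
  by have [_ L _ _] := stage_subalgebra (maxn m n); apply: L; [exact: up|exact: up'].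
- move=> x y [m _ mx] [n _ ny]; exists (maxn m n) => //.
  by have [_ _ M _] := stage_subalgebra (maxn m n); apply: M; [exact: up|exact: up'].
- by move=> x [m _ mx]; exists m => //; have [_ _ _] := stage_subalgebra m; apply.
Qed.

Lemma nil_words E n : [::] \in words E n. Proof. by rewrite mem_words. Qed.

Lemma stage_union_edge e : (\bigcup_n stage n) (s e).
Proof.
pose n := (pickle e).+1; exists n => //.
have eE : e \in edges_upto n by apply: pmap_unpickle_mem.
have <- : mono s p [:: e] (rng e) [::] = s e.
  by rewrite /mono /=; have [_ ->] := CK_projection CK (gen_rng e); rewrite CK_edge_rng.
apply/lin_span_mem/mem_monos; rewrite ?nil_words // ?mem_words /= ?eE //.
exact/mem_inter_closure/sets_upto_rng.
Qed.

Lemma stage_union_base n X : X \in sets_upto n -> (\bigcup_n stage n) (p X).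
Proof.
move=> Xn; exists n => //.
have <- : mono s p [::] X [::] = p X.
  by rewrite /mono /=; have [_ ->] := CK_projection CK (sets_upto_gen Xn).
by apply/lin_span_mem/mem_monos; rewrite ?nil_words //; exact: mem_inter_closure.
Qed.

(** By the relations for [p], the sets [Y] with [p Y] in the union are closed under
    intersections and unions. *)
Lemma stage_union_vertex X : gen_vertex_sets X -> (\bigcup_n stage n) (p X).
Proof.
have [U0 UL UM _] := stage_union_subalgebra; set U := \bigcup_n _ in U0 UL UM *.
move=> gX; suff [] : [set Y | gen_vertex_sets Y /\ U (p Y)] X by [].
apply: gX; split.
  split.
  - by split; [exact: gen_set0 | rewrite (CK_set0 CK)].
  - move=> Y Z [gY UY] [gZ UZ]; split; first exact: gen_setI.
    by rewrite -(CK_setI CK gY gZ); exact: UM.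
  - move=> Y Z [gY UY] [gZ UZ]; split; first exact: gen_setU.
    rewrite (CK_setU CK gY gZ) addrC -scaleN1r; apply: (UL).
      by rewrite -(CK_setI CK gY gZ); exact: UM.
    by rewrite -[p Y]scale1r; exact: UL.
move=> Y [[v _ <-]|[e _ <-]].
  split; first exact: gen_set1.
  apply: (@stage_union_base (pickle v).+1); rewrite mem_cat map_f //.
  exact: pmap_unpickle_mem.
split; first exact: gen_rng.
apply: (@stage_union_base (pickle e).+1); apply: sets_upto_rng.
exact: pmap_unpickle_mem.
Qed.

Lemma no_loop_AF :
  generated_cstar_subalgebra (range s `|` p @` @gen_vertex_sets G) = setT -> AF A.
Proof.
move=> gen; exists stage; split.
- by move=> n; split; [exact: stage_subalgebra | exact: lin_span_finite_dim].
- by move=> n; apply: stage_mono; exact: leqnSn.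
- apply/seteqP; split=> // x _.
  have : generated_cstar_subalgebra (range s `|` p @` @gen_vertex_sets G) x by rewrite gen.
  apply; split.
    split; last exact: closed_closure.
    exact/closure_star_subalgebra/stage_union_subalgebra.
  move=> y [[e _ <-]|[X gX <-]]; apply: subset_closure.
    exact: stage_union_edge.
  exact: stage_union_vertex.
Qed.

End NoLoopAF.

Theorem theorem4p1 (R : realType) (G : ultragraph) (A : cstarAlgType R)
    (s : edge G -> A) (p : set (vertex G) -> A) (hA : is_CstarG s p) :
  AF A <-> ~ (exists a : seq (edge G), is_loop a).
Proof.
split; first exact: AF_no_loop hA.
by move=> noloop; exact: no_loop_AF (CstarG_family hA) noloop (CstarG_generated hA).
Qed.
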